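(* Let $n\ge 1$. An element of $\mathrm{SL}(n,\mathbb{H})$ is reversible in $\mathrm{SL}(n,\mathbb{H})$ if and only if it can be written as a product of two skew-involutions in $\mathrm{SL}(n,\mathbb{H})$.
   Context: $\mathbb{H}$ denotes the real quaternions. Determinant: for $A\in \mathrm{M}(n,\mathbb{H})$ write $A=A_1+A_2\mathbf{j}$ with $A_1,A_2\in \mathrm{M}(n,\mathbb{C})$, and set $\det(A):=\det\begin{pmatrix} A_1 & A_2\\ -\overline{A_2} & \overline{A_1}\end{pmatrix}$. $\mathrm{SL}(n,\mathbb{H})=\{g\in \mathrm{M}(n,\mathbb{H}) : \det(g)=1\}$. An element $g$ of a group $G$ is reversible if $hgh^{-1}=g^{-1}$ for some $h\in G$. An element $g\in\mathrm{SL}(n,\mathbb{H})$ is a skew-involution if $g^2=-\mathrm{I}_n$. *)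

(* Defs.v *)
From HB Require Import structures.
From mathcomp Require Import all_boot all_order all_algebra.
From mathcomp Require Import reals.
From mathcomp.real_closed Require Import complex.
From mathcomp Require Import ring.

Set Implicit Arguments.
Unset Strict Implicit.
Unset Printing Implicit Defensive.

Import GRing.Theory Num.Theory.

Local Open Scope ring_scope.
Local Open Scope complex_scope.

(* Quat a b c d stands for a + b i + c j + d k. *)
Record quat (R : Type) : Type := Quat { qre : R; qi : R; qj : R; qk : R }.

Definition tuple_of_quat (R : Type) (q : quat R) : R * R * R * R :=
  (qre q, qi q, qj q, qk q).

Definition quat_of_tuple (R : Type) (t : R * R * R * R) : quat R :=
  let: (a, b, c, d) := t in Quat a b c d.

Lemma tuple_of_quatK (R : Type) :
  cancel (@tuple_of_quat R) (@quat_of_tuple R).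
Proof. by case. Qed.

HB.instance Definition _ (R : choiceType) :=
  Choice.copy (quat R) (can_type (@tuple_of_quatK R)).

Section QuatRing.
Variable R : realType.
Implicit Types p q r : quat R.

Definition addq p q : quat R :=
  Quat (qre p + qre q) (qi p + qi q) (qj p + qj q) (qk p + qk q).

Definition oppq p : quat R := Quat (- qre p) (- qi p) (- qj p) (- qk p).

Definition mulq p q : quat R :=
  let: Quat a b c d := p in let: Quat a' b' c' d' := q in
  Quat (a * a' - b * b' - c * c' - d * d')
       (a * b' + b * a' + c * d' - d * c')
       (a * c' - b * d' + c * a' + d * b')
       (a * d' + b * c' - c * b' + d * a').

Let zeroq : quat R := Quat 0 0 0 0.
Let oneq : quat R := Quat 1 0 0 0.

Fact addqA : associative addq.
Proof. by move=> p q r; rewrite /addq /=; congr Quat; rewrite addrA. Qed.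

Fact addqC : commutative addq.
Proof. by move=> p q; rewrite /addq /=; congr Quat; rewrite addrC. Qed.

Fact add0q : left_id zeroq addq.
Proof. by case=> a b c d; rewrite /addq /= !add0r. Qed.

Fact addNq : left_inverse zeroq oppq addq.
Proof. by case=> a b c d; rewrite /addq /= !addNr. Qed.

HB.instance Definition _ :=
  GRing.isZmodule.Build (quat R) addqA addqC add0q addNq.

Fact mulqA : associative mulq.
Proof. by case=> ? ? ? ? [? ? ? ?] [? ? ? ?]; congr Quat; ring. Qed.

Fact mul1q : left_id oneq mulq.
Proof. by case=> ? ? ? ?; congr Quat; ring. Qed.

Fact mulq1 : right_id oneq mulq.
Proof. by case=> ? ? ? ?; congr Quat; ring. Qed.

Fact mulqDl : left_distributive mulq addq.
Proof. by case=> ? ? ? ? [? ? ? ?] [? ? ? ?]; congr Quat => /=; ring. Qed.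

Fact mulqDr : right_distributive mulq addq.
Proof. by case=> ? ? ? ? [? ? ? ?] [? ? ? ?]; congr Quat => /=; ring. Qed.

Fact oneq_neq0 : oneq != 0.
Proof. by apply/eqP => -[] /eqP; rewrite oner_eq0. Qed.

HB.instance Definition _ :=
  GRing.Zmodule_isNzRing.Build (quat R)
    mulqA mul1q mulq1 mulqDl mulqDr oneq_neq0.

Definition qunit_i : quat R := Quat 0 1 0 0.
Definition qunit_j : quat R := Quat 0 0 1 0.
Definition qunit_k : quat R := Quat 0 0 0 1.

Lemma hamilton_relations :
  [/\ qunit_i * qunit_i = - 1, qunit_j * qunit_j = - 1,
      qunit_k * qunit_k = - 1 & qunit_i * qunit_j * qunit_k = - 1].
Proof. by split; congr Quat => /=; ring. Qed.

(* The complex numbers are the quaternions with zero j and k coefficients, so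
   that q = qc1 q + (qc2 q) j; see quat_complexE. *)
Definition qcomplex (z : R[i]) : quat R := let: a +i* b := z in Quat a b 0 0.
Definition qc1 q : R[i] := qre q +i* qi q.
Definition qc2 q : R[i] := qj q +i* qk q.

Lemma quat_complexE q : q = qcomplex (qc1 q) + qcomplex (qc2 q) * qunit_j.
Proof. by case: q => a b c d; congr Quat => /=; ring. Qed.

Fact qc1_is_additive : {morph qc1 : p q / p - q}.
Proof. by []. Qed.
Fact qc2_is_additive : {morph qc2 : p q / p - q}.
Proof. by []. Qed.
HB.instance Definition _ :=
  GRing.isZmodMorphism.Build (quat R) R[i] qc1 qc1_is_additive.
HB.instance Definition _ :=
  GRing.isZmodMorphism.Build (quat R) R[i] qc2 qc2_is_additive.

Lemma qc1M p q : qc1 (p * q) = qc1 p * qc1 q - qc2 p * (qc2 q)^*.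
Proof.
by case: p q => ? ? ? ? [? ? ? ?]; apply/eqP; rewrite eq_complex /=;
  apply/andP; split; apply/eqP; ring.
Qed.

Lemma qc2M p q : qc2 (p * q) = qc1 p * qc2 q + qc2 p * (qc1 q)^*.
Proof.
by case: p q => ? ? ? ? [? ? ? ?]; apply/eqP; rewrite eq_complex /=;
  apply/andP; split; apply/eqP; ring.
Qed.

End QuatRing.

Section SpecialLinear.
Variables (R : realType) (n : nat).
Implicit Types (A B : 'M[quat R]_n) (M N : 'M[R[i]]_(n + n)).

Lemma mx_quat_complexE A :
  A = map_mx (@qcomplex R) (map_mx (@qc1 R) A)
      + map_mx (@qcomplex R) (map_mx (@qc2 R) A) *m (qunit_j R)%:M.
Proof.
apply/matrixP=> i j; rewrite !mxE (bigD1 j) //= big1 => [|k kj].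
  by rewrite !mxE eqxx mulr1n addr0 -quat_complexE.
by rewrite !mxE (negbTE kj) mulr0n mulr0.
Qed.

Definition complex_mx A : 'M[R[i]]_(n + n) :=
  let A1 := map_mx (@qc1 R) A in
  let A2 := map_mx (@qc2 R) A in
  block_mx A1 A2 (- map_mx conjc A2) (map_mx conjc A1).

Definition detq A : R[i] := \det (complex_mx A).

Fact map_qc1M A B :
  map_mx (@qc1 R) (A *m B) =
  map_mx (@qc1 R) A *m map_mx (@qc1 R) B
  - map_mx (@qc2 R) A *m map_mx conjc (map_mx (@qc2 R) B).
Proof.
apply/matrixP=> i j; rewrite !mxE raddf_sum -sumrB /=.
by apply: eq_bigr => k _; rewrite qc1M !mxE.
Qed.

Fact map_qc2M A B :
  map_mx (@qc2 R) (A *m B) =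
  map_mx (@qc1 R) A *m map_mx (@qc2 R) B
  + map_mx (@qc2 R) A *m map_mx conjc (map_mx (@qc1 R) B).
Proof.
apply/matrixP=> i j; rewrite !mxE raddf_sum -big_split /=.
by apply: eq_bigr => k _; rewrite qc2M !mxE.
Qed.

Fact map_conjcK (m p : nat) (M : 'M[R[i]]_(m, p)) :
  map_mx conjc (map_mx conjc M) = M.
Proof. by apply/matrixP=> i j; rewrite !mxE conjcK. Qed.

Lemma complex_mxM A B : complex_mx (A *m B) = complex_mx A *m complex_mx B.
Proof.
rewrite /complex_mx mulmx_block map_qc1M map_qc2M.
rewrite map_mxB map_mxD !map_mxM /= !map_conjcK.
rewrite !mulmxN !mulNmx opprD.
by rewrite [X in block_mx _ _ X _ = _]addrC [X in block_mx _ _ _ X = _]addrC.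
Qed.

Lemma complex_mx1 : complex_mx 1%:M = 1%:M.
Proof.
have h1 : map_mx (@qc1 R) (1%:M : 'M_n) = 1%:M.
  by apply/matrixP=> i j; rewrite !mxE raddfMn.
have h2 : map_mx (@qc2 R) (1%:M : 'M_n) = 0.
  by apply/matrixP=> i j; rewrite !mxE raddfMn mul0rn.
by rewrite /complex_mx h1 h2 map_mx1 map_mx0 oppr0 -scalar_mx_block.
Qed.

Lemma complex_mx_inj : injective complex_mx.
Proof.
move=> A B /eq_block_mx [/matrixP h1 /matrixP h2 _ _].
apply/matrixP=> i j; rewrite [LHS]quat_complexE [RHS]quat_complexE.
by have := h1 i j; have := h2 i j; rewrite !mxE => -> ->.
Qed.

Lemma detqM A B : detq (A *m B) = detq A * detq B.
Proof. by rewrite /detq complex_mxM det_mulmx. Qed.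

Lemma detq1 : detq 1%:M = 1.
Proof. by rewrite /detq complex_mx1 det1. Qed.

(* The left inverse of complex_mx, and the ring automorphism of the complex
   matrices whose fixed points are exactly the range of complex_mx. *)
Definition quat_mx M : 'M[quat R]_n :=
  \matrix_(i, j) Quat (complex.Re (ulsubmx M i j)) (complex.Im (ulsubmx M i j))
                      (complex.Re (ursubmx M i j)) (complex.Im (ursubmx M i j)).

Definition twist_mx M : 'M[R[i]]_(n + n) :=
  block_mx (map_mx conjc (drsubmx M)) (- map_mx conjc (dlsubmx M))
           (- map_mx conjc (ursubmx M)) (map_mx conjc (ulsubmx M)).

Fact twist_mxM M N : twist_mx (M *m N) = twist_mx M *m twist_mx N.
Proof.
rewrite /twist_mx -{1 2 3 4}[M]submxK -{1 2 3 4}[N]submxK !mulmx_block.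
rewrite !block_mxKul !block_mxKur !block_mxKdl !block_mxKdr.
rewrite !map_mxD !map_mxM /= !mulmxN !mulNmx !opprK !opprD.
rewrite [X in block_mx X _ _ _ = _]addrC [X in block_mx _ X _ _ = _]addrC.
by rewrite [X in block_mx _ _ X _ = _]addrC [X in block_mx _ _ _ X = _]addrC.
Qed.

Fact twist_complex_mx A : twist_mx (complex_mx A) = complex_mx A.
Proof.
rewrite /twist_mx block_mxKul block_mxKur block_mxKdl block_mxKdr.
by rewrite map_mxN /= !map_conjcK opprK.
Qed.

Fact quat_mxK M : twist_mx M = M -> complex_mx (quat_mx M) = M.
Proof.
have qK1 : map_mx (@qc1 R) (quat_mx M) = ulsubmx M.
  by apply/matrixP=> i j; rewrite !mxE /qc1 /=; case: (M _ _).
have qK2 : map_mx (@qc2 R) (quat_mx M) = ursubmx M.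
  by apply/matrixP=> i j; rewrite !mxE /qc2 /=; case: (M _ _).
rewrite /complex_mx qK1 qK2 => MK; rewrite -[RHS]submxK.
rewrite -[in dlsubmx M]MK -[in drsubmx M]MK.
by rewrite /twist_mx block_mxKdl block_mxKdr.
Qed.

Fact invq_subproof A :
  detq A == 1 ->
  complex_mx (quat_mx (invmx (complex_mx A))) = invmx (complex_mx A).
Proof.
move=> /eqP dA; have uA : complex_mx A \in unitmx.
  by rewrite unitmxE -/(detq A) dA unitr1.
apply: quat_mxK; set N := invmx _.
have : twist_mx N *m complex_mx A = 1%:M.
  by rewrite -[complex_mx A]twist_complex_mx -twist_mxM mulVmx //
             -complex_mx1 twist_complex_mx.
by move=> /(congr1 (mulmx^~ N)); rewrite -mulmxA mulmxV // mulmx1 mul1mx.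
Qed.

Record slH : Type := SLH { slH_val :> 'M[quat R]_n; _ : detq slH_val == 1 }.

HB.instance Definition _ := [isSub for slH_val].
HB.instance Definition _ := [Choice of slH by <:].

Implicit Types g h : slH.

Fact slH_one_subproof : detq 1%:M == 1.
Proof. by rewrite detq1. Qed.

Fact slH_mul_subproof g h : detq (slH_val g *m slH_val h) == 1.
Proof. by rewrite detqM (eqP (valP g)) (eqP (valP h)) mulr1. Qed.

Fact slH_inv_subproof g :
  detq (quat_mx (invmx (complex_mx (slH_val g)))) == 1.
Proof.
by rewrite /detq invq_subproof ?(valP g) // det_inv -/(detq _) (eqP (valP g))
           invr1.
Qed.

Definition slH_one : slH := SLH slH_one_subproof.
Definition slH_mul g h : slH := SLH (slH_mul_subproof g h).
Definition slH_inv g : slH := SLH (slH_inv_subproof g).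

Fact slH_mulA : associative slH_mul.
Proof. by move=> g h k; apply: val_inj; rewrite /= mulmxA. Qed.

Fact slH_mul1 : left_id slH_one slH_mul.
Proof. by move=> g; apply: val_inj; rewrite /= mul1mx. Qed.

Fact slH_mulr1 : right_id slH_one slH_mul.
Proof. by move=> g; apply: val_inj; rewrite /= mulmx1. Qed.

Fact slH_unitmx g : complex_mx (slH_val g) \in unitmx.
Proof. by rewrite unitmxE -/(detq _) (eqP (valP g)) unitr1. Qed.

Fact slH_mulV : left_inverse slH_one slH_inv slH_mul.
Proof.
move=> g; apply/val_inj/complex_mx_inj.
rewrite /= complex_mxM invq_subproof ?(valP g) // mulVmx ?slH_unitmx //.
by rewrite complex_mx1.
Qed.

Fact slH_mulrV : right_inverse slH_one slH_inv slH_mul.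
Proof.
move=> g; apply/val_inj/complex_mx_inj.
rewrite /= complex_mxM invq_subproof ?(valP g) // mulmxV ?slH_unitmx //.
by rewrite complex_mx1.
Qed.

HB.instance Definition _ :=
  isGroup.Build slH slH_mulA slH_mul1 slH_mulr1 slH_mulV slH_mulrV.

Definition skew_involution g : Prop :=
  slH_val g *m slH_val g = - 1%:M.

End SpecialLinear.

Definition reversible (G : groupType) (g : G) : Prop :=
  exists h : G, (h * g * h^-1 = g^-1)%g.

(* Main.v *)
From HB Require Import structures.
Require Import Defs.
From mathcomp Require Import all_boot all_order all_algebra.
From mathcomp Require Import boolp reals.
From mathcomp.real_closed Require Import complex.
From mathcomp Require Import ring lra.

(* [g = s t] with [s], [t] skew-involutions amounts to a skew-involution [s]
   with [s g = g^-1 s]; its determinant is then automatically 1. Given [h] with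
   [h g = g^-1 h], split the identity into idempotents [e] commuting with [g]
   and [h] that cannot be split further. On such an [e], an element commuting
   with [g], [h] and [e] is annihilated by a power of a real prime polynomial.
   If [h^2] has no positive eigenvalue on [e], then [- h^-2] is the square of a
   real polynomial [r] in [h^2] and [s = h r] works. Otherwise rescale [h] in
   the same way to an involution. Put [u = g + g^-1] and [d = g - g^-1], so that
   [u] commutes with [g] and [h], [h d = - d h] and [d^2 = u^2 - 4]. If [u] has
   nonreal eigenvalues, a polynomial [J] in [u] satisfies [J^2 = -1], and
   [s = h J]. If the eigenvalue [a] of [u] is real with [a^2 > 4], then [s] is
   [h d] times a polynomial in [u]. If [a^2 <= 4], [J] is built from a Jordan
   block of the nilpotent element [d] (when [a^2 = 4]) or [u - a] (when
   [a^2 < 4]): with a quaternionic basis of the block on which everything acts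
   by real matrices, [J] is multiplication by the quaternion i, and again
   [s = h J]. *)

Set Implicit Arguments.
Unset Strict Implicit.
Unset Printing Implicit Defensive.

Import Order.TTheory GRing.Theory Num.Theory.
Local Open Scope ring_scope.

(** * Square roots modulo powers of real primes *)

(** Newton's iteration: with [n] the current error, the factor [1 - eps n / 2] cancels it to first
    order and leaves a multiple of [n ^ 2], of which one more power of [pi] is retained. *)
Lemma hensel_sqrt (B : comNzRingType) (half pi w eps r0 t0 : B) :
    half + half = 1 -> eps * eps = 1 -> r0 ^+ 2 * w = eps + pi * t0 ->
  forall m, exists r t, r ^+ 2 * w = eps + pi ^+ m.+1 * t.
Proof.
move=> half2 eps2 E0; elim=> [|m [r [t E]]]; first by exists r0, t0.
set n := pi ^+ m.+1 * t in E.
exists (r * (1 - eps * half * n)).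
exists (pi ^+ m * t ^+ 2 * (half ^+ 2 * (eps + n) - eps)).
have -> : (r * (1 - eps * half * n)) ^+ 2 * w
    = (r ^+ 2 * w) * (1 - (half + half) * eps * n + eps * eps * half ^+ 2 * n ^+ 2).
  by ring.
have -> : pi ^+ m.+2 * (pi ^+ m * t ^+ 2 * (half ^+ 2 * (eps + n) - eps))
    = n ^+ 2 * (half ^+ 2 * (eps + n) - eps).
  rewrite /n !exprS; ring.
rewrite E half2 eps2.
have -> : (eps + n) * (1 - 1 * eps * n + 1 * half ^+ 2 * n ^+ 2)
   = eps + n - (eps * eps) * n + n ^+ 2 * (half ^+ 2 * (eps + n) - eps).
  by ring.
by rewrite eps2; ring.
Qed.

(** * Irreducible real polynomials and first approximations to square roots *)

Section RealPrime.
Variable R : rcfType.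
Implicit Types (P pi : {poly R}).

(** The monic irreducible polynomials over a real closed field; completing the square exhibits the
    roots [a + i b] and [a - i b] in the second case. *)
Definition real_prime pi :=
  (exists a, pi = 'X - a%:P) \/
  (exists a b, b != 0 /\ pi = ('X - a%:P) ^+ 2 + (b ^+ 2)%:P).

(** Take a complex root. If it is not real, the remainder modulo the quadratic with this root has
    degree at most 1 and vanishes at a nonreal point, so it is zero. *)
Lemma real_prime_factor P :
  (1 < size P)%N -> exists pi Q, real_prime pi /\ P = Q * pi.
Proof.
move=> sP.
have /closed_rootP [[a b] rz] : size (map_poly (real_complex R) P) != 1.
  by rewrite size_map_poly; case: (size P) sP => [|[|k]].
have [b0|bn0] := eqVneq b 0.
  exists ('X - a%:P).
  have /factor_theorem [Q ->] : root P a.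
    by move: rz; rewrite b0 complexr0 fmorph_root.
  by exists Q; split=> //; left; exists a.
set pi := ('X - a%:P) ^+ 2 + (b ^+ 2)%:P.
have spi : size pi = 3%N.
  rewrite /pi size_polyDl size_exp_XsubC //.
  exact: leq_ltn_trans (size_polyC_leq1 _) _.
exists pi, (P %/ pi); split; first by right; exists a, b.
rewrite {1}(divp_eq P pi); set q := P %% pi.
suff -> : q = 0 by rewrite addr0.
have sq : (size q <= 2)%N.
  by rewrite -ltnS -spi ltn_modp -size_poly_gt0 spi.
have qE : q = (q`_1)%:P * 'X + (q`_0)%:P.
  apply/polyP => -[|[|i]]; rewrite coefD coefCM coefX coefC /= ?mulr0 ?add0r //.
    by rewrite mulr1 addr0.
  by rewrite ?addr0 nth_default // (leq_trans sq).
have : root (map_poly (real_complex R) q) (a +i* b)%C.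
  move: rz; rewrite {1}(divp_eq P pi) /root rmorphD rmorphM /= hornerD hornerM.
  suff -> : (map_poly (real_complex R) pi).[(a +i* b)%C] = 0.
    by rewrite mulr0 add0r.
  rewrite /pi rmorphD rmorphXn rmorphB /= !map_polyX !map_polyC /=.
  rewrite !hornerE /=; apply/eqP; rewrite eq_complex /= expr2.
  by apply/andP; split; apply/eqP; ring.
rewrite qE rmorphD rmorphM /= !map_polyX !map_polyC /root !hornerE /=.
rewrite eq_complex /= => /andP[/eqP re /eqP im].
have q1 : q`_1 = 0.
  by apply: (mulIf bn0); rewrite mul0r -[RHS]im; ring.
have q0 : q`_0 = 0 by move: re; rewrite q1 !mul0r subr0 add0r.
by rewrite q1 q0 mul0r addr0.
Qed.

(** Modulo the quadratic, [x / b] is a square root of -1. The factor [1] and the sign [(-1) ^+ true]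
    give the shape expected by [peval_sqrt]. *)
Lemma sqrt_seed_scale (b : R) (x : {poly R}) :
  b != 0 ->
  (b^-1%:P * x) ^+ 2 * 1 = (-1) ^+ true + (x ^+ 2 + (b ^+ 2)%:P) * b^-1%:P ^+ 2.
Proof.
move=> bn0; have b1 : b%:P * b^-1%:P = 1 :> {poly R} by rewrite -polyCM divff.
rewrite rmorphXn /=.
transitivity (x ^+ 2 * b^-1%:P ^+ 2 + (b%:P * b^-1%:P) ^+ 2 - 1).
  by rewrite b1; ring.
by rewrite expr1; ring.
Qed.

Lemma sqrt_inv_norm (c : R) : c != 0 -> exists r, r ^+ 2 = (-1) ^+ (c < 0)%R * c^-1.
Proof.
move=> cn0; exists (Num.sqrt `|c|)^-1.
rewrite exprVn sqr_sqrtr ?normr_ge0 // normrEsign invfM.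
by rewrite invr_sign.
Qed.

(** Modulo ['X - a] the polynomial [w] is the constant [c], which a real square can normalise to its
    sign. *)
Lemma sqrt_seed_linear (a c : R) (w q : {poly R}) :
    c != 0 -> w = c%:P + ('X - a%:P) * q ->
  exists r0 t0, r0 ^+ 2 * w = (-1) ^+ (c < 0)%R + ('X - a%:P) * t0.
Proof.
move=> cn0 ->; have [r rE] := sqrt_inv_norm cn0.
have c1 : c^-1%:P * c%:P = 1 :> {poly R} by rewrite -polyCM mulVf.
exists r%:P, ((-1) ^+ (c < 0)%R * c^-1%:P * q).
rewrite -rmorphXn rE rmorphM rmorph_sign /=.
transitivity ((-1) ^+ (c < 0)%R * (c^-1%:P * c%:P)
  + ('X - a%:P) * ((-1) ^+ (c < 0)%R * c^-1%:P * q)); first by ring.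
by rewrite c1 mulr1.
Qed.

(** Modulo the quadratic, ['X] is the nonreal number [a + i b] and [('X - a) / b] is [i], so a
    complex square root [p + i q] of [- 1 / (a + i b)] translates into [r0]. *)
Lemma sqrt_seed_quadratic (a b : R) : b != 0 ->
  exists r0 t0, r0 ^+ 2 * 'X
    = (-1) ^+ true + (('X - a%:P) ^+ 2 + (b ^+ 2)%:P) * t0.
Proof.
move=> bn0; pose z := (a +i* b)%C.
have zn0 : z != 0 by rewrite eq_complex /= negb_and bn0 orbT.
have [p [q [re im]]] : exists p q,
    (p ^+ 2 - q ^+ 2) * a - 2 * p * q * b = -1 /\
    (p ^+ 2 - q ^+ 2) * b + 2 * p * q * a = 0.
  have : sqrtc (- z^-1) ^+ 2 * z = -1 by rewrite sqr_sqrtc mulNr mulVf.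
  case: (sqrtc _) => p q /eqP; rewrite eq_complex expr2 /= => /andP[/eqP re /eqP im].
  exists p, q; split; first by rewrite -re; ring.
  by move: im; rewrite oppr0 => <-; ring.
have b1 : b%:P * b^-1%:P = 1 :> {poly R} by rewrite -polyCM divff.
pose x := 'X - a%:P.
exists (p%:P + q%:P * (b^-1%:P * x)).
exists ((2 * p * q * b)%:P * b^-1%:P ^+ 2 + q%:P ^+ 2 * b^-1%:P ^+ 2 * 'X).
have XE : 'X = a%:P + (b%:P * b^-1%:P) * x by rewrite b1 mul1r addrC subrK.
have reP : (p%:P ^+ 2 - q%:P ^+ 2) * a%:P - 2%:P * p%:P * q%:P * b%:P = -1 :> {poly R}.
  by rewrite -!rmorphXn /= -!polyCM -polyCB -!polyCM -polyCB re polyCN.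
have imP : (p%:P ^+ 2 - q%:P ^+ 2) * b%:P + 2%:P * p%:P * q%:P * a%:P = 0 :> {poly R}.
  by rewrite -!rmorphXn /= -!polyCM -polyCB -!polyCM -polyCD im.
rewrite -/x expr1 -reP !polyCM.
have polyC2 : 2%:P = 2 :> {poly R} by rewrite rmorph_nat.
move: x (a%:P) (b%:P) (b^-1%:P) (p%:P) (q%:P) XE b1 imP {reP}.
rewrite polyC2 => x A B C P Q -> BC imP.
(* Multiples of two vanishing expressions, from [imP] and [B C = 1], are added to reach a plain
   polynomial identity. *)
rewrite -[RHS]addr0 -[in RHS](mulr0 (C * x)) -[in RHS]imP.
rewrite -[RHS]addr0 -[in RHS](mul0r (Q ^+ 2 * (A + B * C * x) + 2 * P * Q * B)).
have <- : 1 - (B * C) ^+ 2 = 0 by rewrite BC expr1n subrr.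
by ring.
Qed.

End RealPrime.

(** * Real polynomials evaluated in an algebra *)

Section Evaluation.
Variables (R : rcfType) (A : nzRingType) (iota : {rmorphism R -> A}).
Hypothesis iotaC : forall c, commr_rmorph iota c.
Implicit Types (c e f g h t x y : A) (P Q pi : {poly R}).

Local Notation peval c := (horner_morph (iotaC c)).

Lemma peval_comm y c P : GRing.comm y c -> GRing.comm y (peval c P).
Proof.
move=> yc; elim/poly_ind: P => [|P a IH]; first by rewrite rmorph0; apply: commr0.
rewrite rmorphD rmorphM /= horner_morphX horner_morphC.
by apply: commrD; [apply: commrM|apply: iotaC].
Qed.

(** Lifting the seed modulo a power of [pi] that kills [e] turns the congruence into an equality on
    [e]. *)
Lemma peval_sqrt c e pi (w r0 t0 : {poly R}) (b : bool) k :
    r0 ^+ 2 * w = (-1) ^+ b + pi * t0 -> peval c pi ^+ k * e = 0 ->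
  exists r, peval c r * peval c r * peval c w * e = (-1) ^+ b * e.
Proof.
move=> E0 pik.
have half2 : (2^-1)%:P + (2^-1)%:P = 1 :> {poly R}.
  have h2 : 2^-1 + 2^-1 = 1 :> R by field.
  by rewrite -polyCD h2.
have eps2 : (-1) ^+ b * (-1) ^+ b = 1 :> {poly R} by rewrite -expr2 sqrr_sign.
have [r [t E]] := hensel_sqrt half2 eps2 E0 k.
exists r; rewrite -!rmorphM /= -expr2 E rmorphD rmorph_sign mulrDl.
rewrite [pi ^+ _ * t]mulrC rmorphM rmorphXn /= exprS.
by rewrite -!mulrA pik !mulr0 addr0.
Qed.

(* [e] does not split into two nonzero idempotents commuting with [g] and [h]. *)
Definition primitive_for g h e :=
  forall f, f * f = f -> f * e = f -> e * f = f ->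
    GRing.comm f g -> GRing.comm f h -> f = 0 \/ f = e.

Hypothesis algebraic : forall c, exists2 P, P != 0 & peval c P = 0.

(** * Commuting elements on a primitive idempotent *)

Section Primitive.
Variables g h e : A.
Hypotheses (ee : e * e = e) (eg : GRing.comm e g) (eh : GRing.comm e h).
Hypothesis e_prim : primitive_for g h e.

(** Fitting decomposition: write a polynomial killing [t] as [q 'X^m] with [q] prime to ['X]. Bezout
    yields an idempotent [f0], the projection onto the part where [t] is invertible, and primitivity
    forces [f0 e] to be 0 or [e]. *)
Lemma fitting t :
    GRing.comm t g -> GRing.comm t h -> GRing.comm t e ->
  (exists k, t ^+ k * e = 0) \/ 
  (exists2 t', (forall y, GRing.comm t y -> GRing.comm t' y) & t' * t * e = e).
Proof.
move=> tg th te.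
have [P Pn0 Pt] := algebraic t.
have [m [q]] := multiplicity_XsubC P 0; rewrite Pn0 /= subr0 => q0 PE.
have cq : coprimep q 'X by rewrite coprimepX.
have [[u1 u2] /= B1] := Bezout_eq1_coprimepP _ _ cq.
have /Bezout_eq1_coprimepP[[v1 v2] /= B2] := coprimep_expr m cq.
have pc y Q : GRing.comm t y -> GRing.comm (peval t Q) y.
  by move=> /commr_sym/peval_comm-/(_ Q)/commr_sym.
have qX0 Q1 Q2 Q : Q1 * Q2 = Q * (q * 'X^m) -> peval t Q1 * peval t Q2 = 0.
  by move=> QE; rewrite -rmorphM QE -PE rmorphM /= Pt mulr0.
have sE : peval t (v1 * q) + peval t (v2 * 'X^m) = 1 by rewrite -rmorphD B2 rmorph1.
set f0 := peval t (v2 * 'X^m) in sE.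
have f0e : GRing.comm f0 e by apply: pc.
have f0f0 : f0 * f0 = f0.
  have : (peval t (v1 * q) + f0) * f0 = f0 by rewrite sE mul1r.
  by rewrite mulrDl (qX0 _ _ (v1 * v2)) ?add0r //; ring.
have tm : peval t 'X^m = t ^+ m by rewrite rmorphXn /= horner_morphX.
have fe_idem : f0 * e * (f0 * e) = f0 * e.
  by rewrite -mulrA [e * _]mulrA -f0e -!mulrA ee mulrA f0f0.
have fer : f0 * e * e = f0 * e by rewrite -mulrA ee.
have fel : e * (f0 * e) = f0 * e by rewrite mulrA -f0e -mulrA ee.
have fc y : GRing.comm t y -> GRing.comm e y -> GRing.comm (f0 * e) y.
  by move=> ty ey; apply/commr_sym/commrM; apply: commr_sym => //; apply: pc.
have [f0z|f1] := e_prim fe_idem fer fel (fc _ tg eg) (fc _ th eh).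
- left; exists m.
  have : (peval t (v1 * q) + f0) * e = e by rewrite sE mul1r.
  rewrite mulrDl f0z addr0 => <-; rewrite -tm mulrA (qX0 _ _ v1) ?mul0r //.
  by ring.
right; exists (peval t u2); first by move=> y; apply: pc.
have qe : peval t q * e = 0.
  by rewrite -f1 mulrA (qX0 _ _ v2) ?mul0r //; ring.
have : peval t (u1 * q + u2 * 'X) * e = e by rewrite B1 rmorph1 mul1r.
by rewrite rmorphD !rmorphM /= horner_morphX mulrDl -mulrA qe mulr0 add0r.
Qed.

(** Induction on the size of a polynomial killing [c] on [e]: a prime factor is either nilpotent on
    [e], or invertible there and can be cancelled. *)
Lemma primary c :
    GRing.comm c g -> GRing.comm c h -> GRing.comm c e -> e != 0 ->
  exists pi k, real_prime pi /\ peval c pi ^+ k * e = 0.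
Proof.
move=> cg ch ce en0.
have [P0 P0n0 P0c] := algebraic c.
have {P0c} : peval c P0 * e = 0 by rewrite P0c mul0r.
have [n] := ubnP (size P0); elim: n P0 P0n0 => // n IH P Pn0 sP Pc.
have [sP1|sP1] := leqP (size P) 1.
  case/eqP: en0; move: Pn0 Pc; rewrite [P](size1_polyC sP1) polyC_eq0 => pn0.
  rewrite horner_morphC => /(congr1 (fun x => iota (P`_0)^-1 * x)).
  by rewrite mulr0 mulrA -rmorphM /= mulVf // rmorph1 mul1r.
have [pi [Q [rpi PE]]] := real_prime_factor sP1.
have pc y : GRing.comm c y -> GRing.comm (peval c pi) y.
  by move=> /commr_sym/peval_comm-/(_ pi)/commr_sym.
have [[k pik]|[t' t'e t'pi]] := fitting (pc _ cg) (pc _ ch) (pc _ ce).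
  by exists pi, k.
have Qn0 : Q != 0 by apply: contraNneq Pn0 => Q0; rewrite PE Q0 mul0r.
have spi : (1 < size pi)%N.
  case: rpi => [[a ->]|[a [b [_ ->]]]]; first by rewrite size_XsubC.
  rewrite size_polyDl size_exp_XsubC //.
  exact: leq_ltn_trans (size_polyC_leq1 _) _.
apply: (IH Q) => //.
  have pin0 : pi != 0 by rewrite -size_poly_gt0 (ltn_trans _ spi).
  rewrite (leq_trans _ (ltnSE sP)) // PE size_mul //.
  by case: (size pi) spi => [|[|s]] // _; rewrite addnS /= addnS ltnS leq_addr.
have t'Q : GRing.comm t' (peval c Q).
  by apply: t'e; rewrite /GRing.comm -!rmorphM mulrC.
rewrite -t'pi !mulrA -t'Q -!mulrA [peval c Q * _]mulrA -rmorphM /= -PE Pc.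
by rewrite mulr0.
Qed.

End Primitive.
End Evaluation.

(** * Jordan blocks *)

Section Block.
Variable A : nzRingType.
Implicit Types (N Q h x y : A).

(* If [Q] is the rank one operator [v phi] with [phi N^j v = 0] for [j < k] and
   [phi N^k v = 1], this is the projection onto the span of [v, ..., N^k v]. *)
Definition block N Q k := \sum_(i < k.+1) N ^+ i * Q * N ^+ (k - i).

Lemma block_comm N Q k :
  N ^+ k.+1 * Q = 0 -> Q * N ^+ k.+1 = 0 -> GRing.comm N (block N Q k).
Proof.
move=> NQ QN; rewrite /GRing.comm /block big_distrr big_distrl /=.
rewrite big_ord_recr [RHS]big_ord_recl /= !mulrA -exprS NQ mul0r addr0.
rewrite expr0 mul1r -mulrA -exprSr subn0 QN add0r.
apply: eq_bigr => i _; rewrite /bump /= add1n !mulrA -exprS -[RHS]mulrA -exprSr.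
by rewrite subnSK.
Qed.

(** Only the diagonal terms survive: off the diagonal, the power of [N] between [Q1] and [Q2] is
    either below [k] or above it, and both kinds vanish. *)
Lemma block_mul N Q1 Q2 k :
    (forall j, (j < k)%N -> Q1 * N ^+ j * Q2 = 0) -> N ^+ k.+1 * Q2 = 0 ->
  block N Q1 k * block N Q2 k = block N (Q1 * N ^+ k * Q2) k.
Proof.
move=> Q12 NQ2.
have mul3 a b : N ^+ a * Q1 * N ^+ (k - a) * (N ^+ b * Q2 * N ^+ (k - b))
    = N ^+ a * (Q1 * N ^+ (k - a + b) * Q2) * N ^+ (k - b).
  by rewrite exprD !mulrA.
rewrite /block big_distrl /=; apply: eq_bigr => a _.
rewrite big_distrr (bigD1 a) //= big1 ?addr0 => [|b ba].
  by rewrite mul3 subnK // -ltnS.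
have ak : (a <= k)%N by rewrite -ltnS.
rewrite mul3; have [ltba|leab] := ltnP b a.
  by rewrite Q12 ?mulr0 ?mul0r // -[X in (_ < X)%N](subnK ak) ltn_add2l.
have ltab : (a < b)%N by rewrite ltn_neqAle leab andbT eq_sym; apply: ba.
have -> : (k - a + b = (b - a).-1 + k.+1)%N.
  by rewrite addnS -addSn prednK ?subn_gt0 // addnC addnBA // addnBAC.
by rewrite exprD -!mulrA (mulrA _ Q2) NQ2 mul0r !mulr0.
Qed.

Variable sg : A.
Hypotheses (sgC : forall x, GRing.comm sg x) (sg2 : sg * sg = 1).

Lemma sgXC k x : GRing.comm (sg ^+ k) x.
Proof. by apply/commr_sym/commrX/commr_sym. Qed.

Lemma sgX2 k : sg ^+ k * sg ^+ k = 1.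
Proof. by rewrite -exprMn_comm // sg2 expr1n. Qed.

Lemma twist_exp N h k : h * N = sg * N * h -> h * N ^+ k = sg ^+ k * N ^+ k * h.
Proof.
move=> hN; elim: k => [|k IH]; first by rewrite !expr0 !mulr1 !mul1r.
rewrite [N ^+ _]exprSr mulrA IH -!mulrA hN [sg ^+ _.+1]exprSr !mulrA; congr (_ * _).
by rewrite -!mulrA (mulrA (N ^+ k)) -(sgC (N ^+ k)) !mulrA.
Qed.

(** Moving [h] across [N^i Q N^(k-i)] costs [sg] to the power [i + k + (k - i) = 2 k], which is
    1. *)
Lemma block_twist N Q h k :
    h * N = sg * N * h -> h * Q = sg ^+ k * Q * h ->
  GRing.comm h (block N Q k).
Proof.
move=> hN hQ; rewrite /GRing.comm /block big_distrr big_distrl /=.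
apply: eq_bigr => i _; have ik : (i <= k)%N by rewrite -ltnS.
have mv j x : x * sg ^+ j = sg ^+ j * x by rewrite sgXC.
have hNj j : h * N ^+ j = sg ^+ j * N ^+ j * h by apply: twist_exp.
have Nhj : N ^+ (k - i) * h = sg ^+ (k - i) * (h * N ^+ (k - i)).
  by rewrite hNj !mulrA sgX2 mul1r.
rewrite -[RHS]mulrA Nhj !mulrA mv hNj -(mulrA _ h Q) hQ !mulrA; do 2 congr (_ * _).
have kE : sg ^+ k = sg ^+ (k - i) * sg ^+ i by rewrite -exprD subnK.
by rewrite mv !mulrA mv kE -(mv i (_ * _)) -[_ * sg ^+ i * sg ^+ i]mulrA sgX2 mulr1.
Qed.

(* [E] is a rank one idempotent and [E A E] a division ring of scalars: [A E]
   plays the role of the column vectors and [E A] of the row vectors. *)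
Variables E half : A.
Hypotheses (halfC : forall x, GRing.comm half x) (half2 : half + half = 1).
Hypothesis EE : E * E = E.
Hypothesis Ediv : forall x, x != 0 -> exists y z, E * y * x * z * E = E.

(** A column [v] generating a chain of length [k + 1] and a row [phi] dual to its end, both chosen
    as eigenvectors of [h], so that blocks built from them are compatible with [h]. *)
Lemma dual_pair N h e k :
    e * e = e -> h * h * e = e -> GRing.comm e h -> GRing.comm e N ->
    h * N = sg * N * h -> N ^+ k * e != 0 -> N ^+ k.+1 * e = 0 ->
  exists tau v phi,
    [/\ forall x, GRing.comm tau x, tau * tau = 1, e * v = v, phi * e = phi
      & v * E = v] /\
    [/\ E * phi = phi, h * v = tau * v, phi * h = sg ^+ k * tau * phi,
      phi * N ^+ k * v = E & forall j, (j < k)%N -> phi * N ^+ j * v = 0].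
Proof.
move=> ee hhe eh eN hN Nk Nk1.
(* The sign [tau] is 1 or -1: the two candidates add up to twice [N^k e], so they cannot both
   vanish. *)
have [tau [tauC tau2 xn0]] : exists tau, [/\ forall x, GRing.comm tau x,
    tau * tau = 1 & N ^+ k * e * (1 + tau * h) != 0].
  have [z1|] := eqVneq (N ^+ k * e * (1 + 1 * h)) 0; last first.
    by exists 1; split=> [x||//]; [apply/commr_sym/commr1|rewrite mulr1].
  have [z2|] := eqVneq (N ^+ k * e * (1 + -1 * h)) 0; last first.
    by exists (-1); split=> [x||//]; [apply/commr_sym/commrN1|rewrite mulrNN mulr1].
  case/eqP: Nk; rewrite -[LHS]mul1r -half2 mulrDl -mulrDr.
  have : N ^+ k * e * (1 + 1 * h + (1 + -1 * h)) = 0 by rewrite mulrDr z1 z2 addr0.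
  rewrite mulN1r mul1r addrACA subrr addr0 => z3.
  by rewrite -[N ^+ k * e]mulr1 -mulrDr z3 mulr0.
have ehh : h * e * h = e by rewrite -eh -mulrA (commrM eh eh).
have [y [z yxz]] := Ediv xn0.
have mt a x : x * (tau * a) = tau * (x * a) by rewrite mulrA -tauC mulrA.
have ms j a x : x * (sg ^+ j * a) = sg ^+ j * (x * a).
  by rewrite mulrA -sgXC mulrA.
(* [th] is the eigenvalue of [h] on [N^k v], hence the one needed for the row [phi]. *)
have [th thE] : exists th, th = sg ^+ k * tau by eexists.
have th2 : th * th = 1 by rewrite thE ms !mulrA sgX2 mul1r tau2.
have thC x : GRing.comm th x by rewrite /GRing.comm thE -mulrA tauC ms.
have mth a x : x * (th * a) = th * (x * a) by rewrite mulrA -thC mulrA.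
have mh a x : x * (half * a) = half * (x * a) by rewrite mulrA -halfC mulrA.
have [v0 v0E] : exists v0, v0 = e * (1 + tau * h) * z * E by eexists.
have [phi phiE] : exists phi, phi = half * (E * y * e * (1 + th * h)) by eexists.
have hv0 : h * v0 = tau * v0.
  rewrite v0E !mulrA; do 2 congr (_ * _).
  rewrite !mulrDr !mulr1 mt ehh [tau * e * _]mt addrC; congr (_ + _).
  by rewrite !mulrA tau2 mul1r eh.
have phih : phi * h = th * phi.
  have hh1 : E * y * e * h * h = E * y * e.
    by rewrite -!mulrA [e * _](commrM eh eh) hhe.
  rewrite phiE -mulrA [RHS]mh; congr (_ * _); set w := E * y * e in hh1 *.
  rewrite mulrDr mulr1 mth mulrDl -mulrA hh1 mulrDr addrC; congr (_ + _).
  by rewrite mulrA th2 mul1r.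
have Nhv v : h * v = tau * v -> h * (N ^+ k * v) = th * (N ^+ k * v).
  by move=> hv; rewrite mulrA twist_exp // -mulrA hv mt thE !mulrA -tauC.
have phiNv0 : phi * N ^+ k * v0 = E.
  have eNv : e * (N ^+ k * v0) = N ^+ k * v0.
    by rewrite mulrA (commrX _ eN) -mulrA v0E !mulrA -(mulrA _ e e) ee.
  rewrite phiE -!mulrA mulrDl mul1r -mulrA (Nhv _ hv0) [th * _]mulrA th2 mul1r.
  rewrite mulrDr eNv !mulrDr -mulrDl half2 mul1r v0E !mulrA.
  by move: yxz; rewrite !mulrA.
have Ephi : E * phi = phi by rewrite phiE mh !mulrA -(mulrA half) EE.
have phie : phi * e = phi.
  have ec : (1 + th * h) * e = e * (1 + th * h).
    by rewrite mulrDl mul1r -mulrA -eh mulrDr mulr1 mth.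
  by rewrite phiE -!mulrA ec !mulrA -(mulrA _ e e) ee.
have phi_v0 : [/\ e * v0 = v0, v0 * E = v0 & h * v0 = tau * v0].
  by split=> //; [rewrite v0E !mulrA ee|rewrite v0E -!mulrA EE].
(* Orthogonalisation from the top degree down: stage [i] clears the pairings with [k - i <= j < k],
   and passing to the next stage subtracts [N^(i+1) v q]. *)
suff /(_ k) [v [[ev vE hv] phiNv phiNjv]] : forall i, exists v,
    [/\ [/\ e * v = v, v * E = v & h * v = tau * v], phi * N ^+ k * v = E
    & forall j, (k <= i + j)%N -> (j < k)%N -> phi * N ^+ j * v = 0].
  exists tau, v, phi; split; split=> //; first by rewrite -thE.
  by move=> j; apply: phiNjv; apply: leq_addr.
elim=> [|i [v [[ev vE hv] phiNv phiNjv]]].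
  exists v0; split=> // j; rewrite add0n => kj; by rewrite ltnNge kj.
have [ik|ki] := ltnP i k; last first.
  by exists v; split=> // j _; apply: phiNjv; apply: leq_trans ki (leq_addr _ _).
have Nv0 j : (k < j)%N -> N ^+ j * v = 0.
  by move=> kj; rewrite -(subnK kj) exprD -ev mulrA -(mulrA _ _ e) Nk1 mulr0 mul0r.
pose m := (k - i.+1)%N; have mi : (m + i.+1 = k)%N by rewrite subnK.
have [q qE] : exists q, q = phi * N ^+ m * v by eexists.
have hNv j : h * (N ^+ j * v) = sg ^+ j * (tau * (N ^+ j * v)).
  by rewrite mulrA twist_exp // -!mulrA hv mt.
(* Evaluating [phi h N^m v] in two ways gives this; it makes the correction [N^(i+1) v q] an
   eigenvector of [h] for the same [tau]. *)
have sgq : sg ^+ i.+1 * q = q.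
  have : th * q = sg ^+ m * (tau * q).
    rewrite qE -!mulrA; transitivity (phi * h * (N ^+ m * v)).
      by rewrite phih -!mulrA.
    by rewrite -mulrA hNv ms mt.
  have cs x : sg ^+ m * (sg ^+ m * x) = x by rewrite mulrA sgX2 mul1r.
  have ct x : tau * (tau * x) = x by rewrite mulrA tau2 mul1r.
  rewrite thE -mi exprD -!mulrA => /(congr1 (fun x => tau * (sg ^+ m * x))).
  by rewrite !cs mt !ct.
have Eq : E * q = q by rewrite qE !mulrA Ephi.
have qEr : q * E = q by rewrite qE -!mulrA vE.
have phiNw j : phi * N ^+ j * (v - N ^+ i.+1 * (v * q))
    = phi * N ^+ j * v - phi * (N ^+ (j + i.+1) * v) * q.
  by rewrite mulrBr exprD !mulrA.
exists (v - N ^+ i.+1 * (v * q)); split; first split.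
- rewrite mulrBr ev [e * (_ * _)]mulrA (commrX _ eN).
  by rewrite -[_ * e * _]mulrA [e * _]mulrA ev.
- by rewrite mulrBl vE -!mulrA qEr.
- rewrite !mulrBr hv [_ ^+ _ * (v * q)]mulrA [h * (_ * q)]mulrA hNv.
  by rewrite -[_ * q]mulrA -ms sgq -[_ * q]mulrA.
- by rewrite phiNw phiNv Nv0 ?mulr0 ?mul0r ?subr0 // addnS ltnS leq_addr.
move=> j kj jk; rewrite phiNw.
have [jm|jm] := eqVneq j m; first by rewrite jm mi mulrA phiNv -qE Eq subrr.
have mj : (m < j)%N by rewrite ltn_neqAle eq_sym jm leq_subLR.
rewrite Nv0 ?mulr0 ?mul0r ?subr0; last by rewrite -mi ltn_add2r.
by apply: phiNjv => //; move: mj; rewrite ltn_subLR // addSnnS // addnS.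
Qed.

Variable I0 : A.
Hypotheses (I0E : I0 * E = I0) (I02 : I0 * I0 = - E).
Hypothesis E0 : E != 0.

Lemma block_absorbl N Q k a :
  GRing.comm a N -> a * Q = Q -> a * block N Q k = block N Q k.
Proof.
move=> aN aQ; rewrite /block big_distrr; apply: eq_bigr => i _ /=.
by rewrite !mulrA (commrX _ aN) -(mulrA _ a) aQ.
Qed.

Lemma block_absorbr N Q k a :
  GRing.comm a N -> Q * a = Q -> block N Q k * a = block N Q k.
Proof.
move=> aN Qa; rewrite /block big_distrl; apply: eq_bigr => i _ /=.
by rewrite -!mulrA -(commrX _ aN) (mulrA Q) Qa.
Qed.

Lemma block_commutes N Q k y :
  GRing.comm y N -> GRing.comm y Q -> GRing.comm y (block N Q k).
Proof.
move=> yN yQ; apply: commr_sum => i _.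
by do !apply: commrM => //; apply: commrX.
Qed.

Lemma blockN N Q k : block N (- Q) k = - block N Q k.
Proof. by rewrite /block -sumrN; apply: eq_bigr => i _; rewrite mulrN mulNr. Qed.

(* [J] acts on the chain [v, ..., N^k v] by the scalar [I0], and therefore
   commutes with [N] and [h]. *)
Lemma odd_block N h e k :
    e * e = e -> h * h * e = e -> GRing.comm e h -> GRing.comm e N ->
    h * N = sg * N * h -> N ^+ k * e != 0 -> N ^+ k.+1 * e = 0 ->
  exists p J, [/\ p != 0, p * p = p, e * p = p & p * e = p] /\
    [/\ J * J = - p, e * J = J, J * e = J,
        GRing.comm N p /\ GRing.comm N J & GRing.comm h p /\ GRing.comm h J].
Proof.
move=> ee hhe eh eN hN Nk Nk1.
have [tau [v [phi [[tauC tau2 ev phie vE] [Ephi hv phih phiNv phiNjv]]]]] :=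
  dual_pair ee hhe eh eN hN Nk Nk1.
have mul c d j : v * c * phi * N ^+ j * (v * d * phi)
    = v * c * (phi * N ^+ j * v) * d * phi by rewrite !mulrA.
have Nv : N ^+ k.+1 * v = 0 by rewrite -ev mulrA Nk1 mul0r.
have phiN : phi * N ^+ k.+1 = 0.
  by rewrite -phie -mulrA (commrX _ eN) Nk1 mulr0.
have mulj c d j : (j < k)%N -> v * c * phi * N ^+ j * (v * d * phi) = 0.
  by move=> jk; rewrite mul phiNjv // mulr0 !mul0r.
have NQ c : N ^+ k.+1 * (v * c * phi) = 0 by rewrite !mulrA Nv !mul0r.
have QN c : v * c * phi * N ^+ k.+1 = 0 by rewrite -!mulrA phiN !mulr0.
have hQ c : h * (v * c * phi) = sg ^+ k * (v * c * phi) * h.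
  have ms x y : x * (sg ^+ k * y) = sg ^+ k * (x * y).
    by rewrite mulrA -sgXC mulrA.
  rewrite -[RHS]mulrA -[_ * phi * h]mulrA phih -[sg ^+ k * tau * phi]mulrA ms.
  by rewrite [RHS]mulrA sgX2 mul1r [RHS]mulrA -tauC !mulrA hv.
have NC c : GRing.comm N (block N (v * c * phi) k) by apply: block_comm.
have hC c : GRing.comm h (block N (v * c * phi) k).
  by apply: block_twist => //; apply: hQ.
have eC c : e * block N (v * c * phi) k = block N (v * c * phi) k.
  by apply: block_absorbl => //; rewrite !mulrA ev.
have Ce c : block N (v * c * phi) k * e = block N (v * c * phi) k.
  by apply: block_absorbr => //; rewrite -!mulrA phie.
have mulQ c d : block N (v * c * phi) k * block N (v * d * phi) k
    = block N (v * (c * E * d) * phi) k.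
  rewrite block_mul // => [|j jk]; last exact: mulj.
  by rewrite mul phiNv !mulrA.
exists (block N (v * E * phi) k), (block N (v * I0 * phi) k).
split; split=> //; last 1 first.
- by rewrite mulQ I0E I02 mulrN mulNr blockN.
- have -> : v * E * phi = v * phi by rewrite vE.
  apply: contraNneq E0 => p0.
  (* Applied to [v], only the term of index 0 survives and gives back [v], which is nonzero since
     [phi N^k v = E]. *)
  have : block N (v * phi) k * v = 0 by rewrite p0 mul0r.
  rewrite /block big_distrl big_ord_recl big1 /= => [|i _].
    rewrite expr0 mul1r subn0 addr0 -!mulrA (mulrA phi) phiNv vE => v0.
    by rewrite -phiNv v0 mulr0.
  rewrite -!mulrA (mulrA phi) phiNjv ?mulr0 // /bump add1n.
  by rewrite ltn_subrL /= (leq_ltn_trans _ (ltn_ord i)).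
- by rewrite mulQ !EE.
Qed.

End Block.

Section EvenBlock.
Variable A : nzRingType.
Variables E half I0 : A.
Hypotheses (halfC : forall x, GRing.comm half x) (half2 : half + half = 1).
Hypotheses (EE : E * E = E) (E0 : E != 0).
Hypothesis Ediv : forall x, x != 0 -> exists y z, E * y * x * z * E = E.
Hypotheses (I0E : I0 * E = I0) (I02 : I0 * I0 = - E).

(* Here [h] and [N] commute, and [h] has eigenvalue 1 or -1 on the chain of [v]
   and the opposite one on the chain of [I v], whence the term [I v phi I]. *)
Lemma even_block (N h I e : A) k :
    e * e = e -> h * h * e = e -> GRing.comm e h -> GRing.comm e N ->
    GRing.comm h N -> N ^+ k * e != 0 -> N ^+ k.+1 * e = 0 ->
    I * I * e = - e -> h * I = - (I * h) -> GRing.comm I N -> GRing.comm e I ->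
  exists p J, [/\ p != 0, p * p = p, e * p = p & p * e = p] /\
    [/\ J * J = - p, e * J = J, J * e = J,
        [/\ GRing.comm N p, GRing.comm h p & GRing.comm I p]
      & [/\ GRing.comm N J, GRing.comm h J & GRing.comm I J]].
Proof.
move=> ee hhe eh eN hN Nk Nk1 IIe hI IN eI.
have sgC (x : A) : GRing.comm 1 x by apply/commr_sym/commr1.
have hN1 : h * N = 1 * N * h by rewrite mul1r.
have [tau [v [phi [[tauC tau2 ev phie vE] [Ephi hv phih phiNv phiNjv]]]]] :=
  dual_pair sgC (mulr1 1) halfC half2 EE Ediv ee hhe eh eN hN1 Nk Nk1.
rewrite expr1n mul1r in phih.
(* [I v] has the opposite eigenvalue under [h], so the pairing equals its own negative. *)
have phiNIv j : phi * N ^+ j * (I * v) = 0.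
  have [x xE] : exists x, x = phi * N ^+ j * (I * v) by eexists.
  rewrite -xE.
  have xx : tau * x = - (tau * x).
    have mt a y : y * (tau * a) = tau * (y * a) by rewrite mulrA -tauC mulrA.
    rewrite {1}xE !mulrA -phih -(mulrA phi h) (commrX j hN) !mulrA.
    by rewrite -(mulrA _ h I) hI mulrN mulNr -!mulrA hv !mt xE !mulrA.
  have : tau * x = 0.
    by rewrite -[LHS]mul1r -half2 mulrDl {2}xx mulrN subrr.
  by move=> /(congr1 ( *%R tau)); rewrite mulrA tau2 mul1r mulr0.
(* The row [- phi I] is dual to the column [I v]; the sum of both terms commutes with [h] and with
   [I]. *)
pose Q c := v * c * phi - I * v * c * phi * I.
have IIv : I * (I * v) = - v.
  by rewrite -[in LHS]ev !mulrA IIe mulNr ev.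
have NIv j : phi * I * N ^+ j * v = 0.
  by rewrite -(mulrA phi) (commrX j IN) -!mulrA (mulrA phi) phiNIv.
have NIIv j : phi * I * N ^+ j * (I * v) = - (phi * N ^+ j * v).
  rewrite -(mulrA phi) (commrX j IN) -!mulrA IIv !mulrN; done.
have mul c d j : Q c * N ^+ j * Q d
    = v * c * (phi * N ^+ j * v) * d * phi
      - I * v * c * (phi * N ^+ j * v) * d * phi * I.
  have -> : Q c * N ^+ j * Q d
    = v * c * (phi * N ^+ j * v) * d * phi
      - v * c * (phi * N ^+ j * (I * v)) * d * phi * I
      - (I * v * c * (phi * I * N ^+ j * v) * d * phi
      - I * v * c * (phi * I * N ^+ j * (I * v)) * d * phi * I).
    by rewrite /Q mulrBl mulrBl !mulrBr !mulrA.
  by rewrite phiNIv NIv NIIv !mulr0 !mul0r sub0r subr0 mulrN !mulNr opprK.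
have Nv : N ^+ k.+1 * v = 0 by rewrite -ev mulrA Nk1 mul0r.
have phiN : phi * N ^+ k.+1 = 0.
  by rewrite -phie -mulrA (commrX _ eN) Nk1 mulr0.
have mulj c d j : (j < k)%N -> Q c * N ^+ j * Q d = 0.
  by move=> jk; rewrite mul phiNjv // !mulr0 !mul0r subrr.
have NQ c : N ^+ k.+1 * Q c = 0.
  rewrite /Q mulrBr !mulrA Nv !mul0r.
  by rewrite -(commrX _ IN) -(mulrA I) Nv mulr0 !mul0r subrr.
have QN c : Q c * N ^+ k.+1 = 0.
  rewrite /Q mulrBl -!mulrA (commrX _ IN) (mulrA phi) phiN.
  by rewrite !mul0r !mulr0 subrr.
have hQ c : GRing.comm h (Q c).
  have hw : h * (v * c * phi) = tau * (v * c * phi) by rewrite !mulrA hv.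
  have wh : v * c * phi * h = tau * (v * c * phi).
    by rewrite -mulrA phih mulrA -tauC !mulrA.
  have -> : Q c = v * c * phi - I * (v * c * phi) * I by rewrite /Q !mulrA.
  move: (v * c * phi) hw wh => w hw wh.
  rewrite /GRing.comm mulrBr mulrBl hw wh; congr (_ - _).
  rewrite !mulrA hI !mulNr -(mulrA I h) hw.
  have Ih : I * h = - (h * I) by rewrite hI opprK.
  by rewrite -[RHS]mulrA Ih mulrN [I * w * _]mulrA -(mulrA I w) wh.
have IQ c : GRing.comm I (Q c).
  have IIw : I * (I * (v * c * phi)) = - (v * c * phi).
    by rewrite -!mulrA (mulrA I v) (mulrA I (I * v)) IIv mulNr.
  have wII : v * c * phi * I * I = - (v * c * phi).
    have eII : e * (I * I) = - e by rewrite (commrM eI eI) IIe.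
    by rewrite -phie -!mulrA eII !mulrN.
  have -> : Q c = v * c * phi - I * (v * c * phi) * I by rewrite /Q !mulrA.
  move: (v * c * phi) IIw wII => w IIw wII.
  have IIwI : I * (I * w * I) = - (w * I) by rewrite mulrA IIw mulNr.
  have IwII : I * w * I * I = - (I * w) by rewrite -(mulrA I w) -mulrA wII mulrN.
  by rewrite /GRing.comm mulrBr mulrBl IIwI IwII !opprK addrC.
have eQ c : e * Q c = Q c by rewrite /Q mulrBr !mulrA ev eI -[I * e * v]mulrA ev.
have Qe c : Q c * e = Q c.
  by rewrite /Q mulrBl -!mulrA phie -eI (mulrA phi) phie.
have NC c : GRing.comm N (block N (Q c) k) by apply: block_comm.
have mulQ c d : c * E = c -> block N (Q c) k * block N (Q d) k = block N (Q (c * d)) k.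
  move=> cE; rewrite block_mul // => [|j jk]; last exact: mulj.
  by rewrite mul phiNv /Q -![_ * c * E]mulrA cE !mulrA.
exists (block N (Q E) k), (block N (Q I0) k); split; split=> //.
- apply: contraNneq E0 => p0.
  have : block N (Q E) k * v = 0 by rewrite p0 mul0r.
  have QNv j : Q E * N ^+ j * v = v * (phi * N ^+ j * v).
    have := congr1 (fun x => I * v * E * x) (NIv j); rewrite mulr0 !mulrA => z.
    by rewrite /Q !mulrBl z subr0 vE ?mulrA.
  rewrite /block big_distrl big_ord_recl big1 /= => [|i _].
    rewrite expr0 mul1r subn0 addr0 QNv phiNv vE => v0.
    by rewrite -phiNv v0 mulr0.
  rewrite -!mulrA (mulrA (Q E)) QNv phiNjv ?mulr0 // /bump add1n.
  by rewrite ltn_subrL /= (leq_ltn_trans _ (ltn_ord i)).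
- by rewrite mulQ ?EE.
- exact: block_absorbl.
- exact: block_absorbr.
- rewrite mulQ // I02 -blockN; congr block.
  by rewrite /Q !(mulrN, mulNr) opprB opprK addrC.
- exact: block_absorbl.
- exact: block_absorbr.
- by split=> //; apply: block_commutes.
- by split=> //; apply: block_commutes.
Qed.
End EvenBlock.

(** * Solving [s g = g^-1 s] *)

Section Solve.
Variables (R : rcfType) (A : nzRingType) (iota : {rmorphism R -> A}).
Hypothesis iotaC : forall c, commr_rmorph iota c.
Local Notation peval c := (horner_morph (iotaC c)).
Hypothesis algebraic : forall c, exists2 P, P != 0 & peval c P = 0.
Variable rank : A -> nat.
Hypothesis rank_lt : forall e f, e * e = e -> f * f = f -> e * f = f ->
  f * e = f -> f <> e -> (rank f < rank e)%N.
Variables E I0 : A.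
Hypotheses (EE : E * E = E) (E0 : E != 0).
Hypothesis Ediv : forall x, x != 0 -> exists y z, E * y * x * z * E = E.
Hypotheses (I0E : I0 * E = I0) (I02 : I0 * I0 = - E).

Let half := iota 2^-1.
Let halfC x : GRing.comm half x.
Proof. exact/commr_sym/iotaC. Qed.
Let half2 : half + half = 1.
Proof.
have h2 : 2^-1 + 2^-1 = 1 :> R by field.
by rewrite -rmorphD h2 rmorph1.
Qed.

Variables g g' : A.
Hypotheses (gg' : g * g' = 1) (g'g : g' * g = 1).

(** A solution in the corner ring [e A e] with unit [e]; solutions on orthogonal idempotents can be
    added. *)
Definition inverting e s := [/\ e * s = s, s * e = s, s * s = - e & s * g = g' * s].

Lemma inverting_corner e s :
    e * e = e -> GRing.comm e g -> GRing.comm e s ->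
    s * s * e = - e -> s * g = g' * s ->
  inverting e (s * e).
Proof.
move=> ee eg es sse sg; split.
- by rewrite mulrA es -mulrA ee.
- by rewrite -mulrA ee.
- by rewrite mulrA -(mulrA s e s) es -!mulrA ee mulrA.
- by rewrite -mulrA eg !mulrA sg.
Qed.

(* [K * e = e] is any condition on [e] that smaller idempotents inherit. *)
Lemma inverting_ind h K :
    (forall e, e != 0 -> e * e = e -> GRing.comm e g -> GRing.comm e h ->
       K * e = e -> primitive_for g h e -> exists s, inverting e s) ->
  forall e, e * e = e -> GRing.comm e g -> GRing.comm e h -> K * e = e ->
    exists s, inverting e s.
Proof.
move=> prim e; have [n] := ubnP (rank e); elim: n e => // n IH e rn ee eg eh Ke.
have [->|en0] := eqVneq e 0.
  by exists 0; split; rewrite ?mulr0 ?mul0r ?oppr0.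
have [[f [[ff fe ef] fg fh fn0 fne]]|nf] := pselect (exists f,
  [/\ [/\ f * f = f, f * e = f & e * f = f], GRing.comm f g, GRing.comm f h,
      f <> 0 & f <> e]); last first.
  apply: prim => // f ff fe ef fg fh.
  have [->|/eqP fn0] := eqVneq f 0; first by left.
  have [->|/eqP fne] := eqVneq f e; first by right.
  by case: nf; exists f.
pose f2 := e - f.
have f2E : f2 = e - f by [].
have ff2 : f * f2 = 0 by rewrite f2E mulrBr fe ff subrr.
have f2f : f2 * f = 0 by rewrite f2E mulrBl ef ff subrr.
have f2f2 : f2 * f2 = f2 by rewrite {2}f2E mulrBr f2f subr0 f2E mulrBl ee fe.
have ef2 : e * f2 = f2 by rewrite f2E mulrBr ee ef.
have f2e : f2 * e = f2 by rewrite f2E mulrBl ee fe.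
have rf : (rank f < n)%N by apply: leq_trans (rank_lt ee ff ef fe fne) _.
have rf2 : (rank f2 < n)%N.
  apply: leq_trans (rank_lt ee f2f2 ef2 f2e _) _ => //.
  by rewrite f2E => /eqP; rewrite -subr_eq0 addrAC subrr add0r oppr_eq0 => /eqP.
have cf2 y : GRing.comm e y -> GRing.comm f y -> GRing.comm f2 y.
  by move=> ey fy; apply: commr_sym; apply: commrB; apply: commr_sym.
have Kf : K * f = f by rewrite -ef mulrA Ke.
have Kf2 : K * f2 = f2 by rewrite -ef2 mulrA Ke.
have [s1 [fs1 s1f s1s1 s1g]] := IH f rf ff fg fh Kf.
have [s2 [fs2 s2f s2s2 s2g]] := IH f2 rf2 f2f2 (cf2 _ eg fg) (cf2 _ eh fh) Kf2.
(* The corners of [f] and [e - f] annihilate each other, so [s1 + s2] squares to [- e]. *)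
have s12 : s1 * s2 = 0 by rewrite -s1f -fs2 mulrA -(mulrA s1) ff2 mulr0 mul0r.
have s21 : s2 * s1 = 0 by rewrite -s2f -fs1 mulrA -(mulrA s2) f2f mulr0 mul0r.
exists (s1 + s2); split.
- by rewrite mulrDr -{1}fs1 -{1}fs2 !mulrA ef ef2 fs1 fs2.
- by rewrite mulrDl -{1}s1f -{1}s2f -!mulrA fe f2e s1f s2f.
- by rewrite mulrDl !mulrDr s12 s21 addr0 add0r s1s1 s2s2 f2E -opprD addrC subrK.
by rewrite mulrDl mulrDr s1g s2g.
Qed.

(** * Reversers, with [u = g + g^-1] and [d = g - g^-1] *)

Section Reverser.
Variable h : A.
Hypothesis hg : h * g = g' * h.

Lemma reverser_sym : h * g' = g * h.
Proof.
have : g * (h * g) * g' = g * h by rewrite -!mulrA gg' mulr1.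
by rewrite hg mulrA gg' mul1r.
Qed.

Let u := g + g'.
Let d := g - g'.

Let ug : GRing.comm u g.
Proof. by rewrite /GRing.comm mulrDl mulrDr gg' g'g. Qed.
Let uh : GRing.comm u h.
Proof. by rewrite /GRing.comm mulrDl mulrDr hg reverser_sym addrC. Qed.
Let hd : h * d = - (d * h).
Proof. by rewrite mulrBr mulrBl hg reverser_sym opprB. Qed.
Let dg : GRing.comm d g.
Proof. by rewrite /GRing.comm mulrBl mulrBr gg' g'g. Qed.
Let du : GRing.comm d u.
Proof.
by apply/commrD => //; rewrite /GRing.comm /d mulrBl mulrBr gg' g'g.
Qed.
Let wu : peval u ('X ^+ 2 - 4%:P) = d * d.
Proof.
rewrite rmorphB rmorphXn /= horner_morphX horner_morphC rmorph_nat expr2.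
have -> : u * u = g * g + g' * g' + (1 + 1).
  by rewrite /u mulrDl !mulrDr gg' g'g [1 + g' * _]addrC addrACA.
have -> : d * d = g * g + g' * g' - (1 + 1).
  by rewrite /d mulrBl !mulrBr gg' g'g opprB addrACA -opprD.
rewrite -addrA; congr (_ + _).
have -> : 4 = (1 + 1) + (1 + 1) :> A by rewrite -[1 + 1]/(2%:R) -natrD.
by rewrite opprD addrA subrr sub0r.
Qed.

Lemma commutes_with_g y : GRing.comm y u -> GRing.comm y d -> GRing.comm y g.
Proof.
have gE : g = half * (u + d).
  by rewrite /u /d addrACA subrr addr0 mulrDr -mulrDl half2 mul1r.
move=> yu yd; rewrite gE; apply: commrM; first exact: iotaC.
exact: commrD.
Qed.

Variable e : A.
Hypotheses (en0 : e != 0) (ee : e * e = e) (eg : GRing.comm e g).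
Hypotheses (eh : GRing.comm e h) (hhe : h * h * e = e).
Hypothesis e_prim : primitive_for g h e.

Let eg' : GRing.comm e g'.
Proof.
have : g' * (e * g) * g' = g' * e by rewrite -!mulrA gg' mulr1.
by rewrite eg !mulrA g'g mul1r.
Qed.
Let eu : GRing.comm e u. Proof. exact: commrD. Qed.
Let ed : GRing.comm e d. Proof. exact: commrB. Qed.

Lemma inverting_mul J : e * J = J -> J * e = J -> J * J = - e ->
  GRing.comm J g -> GRing.comm J h -> inverting e (h * J).
Proof.
move=> eJ Je JJ Jg Jh; split.
- by rewrite mulrA eh -mulrA eJ.
- by rewrite -mulrA Je.
- by rewrite -mulrA (mulrA J) Jh -mulrA JJ !mulrN mulrA hhe.
- by rewrite -mulrA Jg !mulrA hg.
Qed.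

Lemma nilpotent_index N : (exists k, N ^+ k * e = 0) ->
  exists k, N ^+ k * e != 0 /\ N ^+ k.+1 * e = 0.
Proof.
case=> k; elim: k => [|k IH] Nk.
  by case/eqP: en0; rewrite -Nk expr0 mul1r.
by have [/IH|Nk0] := eqVneq (N ^+ k * e) 0; last by exists k.
Qed.

Let one_w0 (r : {poly R}) : peval u r * peval u r * peval u 1 = peval u r * peval u r.
Proof. by rewrite rmorph1 mulr1. Qed.

Lemma involution_solution : exists s, inverting e s.
Proof.
have [pi [k [[[a piE]|[a [b [bn0 piE]]]] pik]]] :=
    primary algebraic ee eg eh e_prim ug uh (commr_sym eu) en0; last first.
  have E0' := sqrt_seed_scale ('X - a%:P) bn0; rewrite -piE in E0'.
  have [r] := peval_sqrt E0' pik; rewrite one_w0 mulN1r => rr.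
  have ur : GRing.comm (peval u r) e by apply/commr_sym/peval_comm.
  exists (h * (peval u r * e)).
  have pc y : GRing.comm u y -> GRing.comm e y -> GRing.comm (peval u r * e) y.
    move=> uy ey; apply/commr_sym/commrM; last exact: commr_sym.
    exact/peval_comm/commr_sym.
  apply: inverting_mul; [| | |exact: pc|exact: pc].
  - by rewrite mulrA -ur -mulrA ee.
  - by rewrite -mulrA ee.
  by rewrite -mulrA (mulrA e) -ur -!mulrA ee mulrA rr.
have [N NE] : exists N, N = u - iota a by eexists.
have uE : u = N + iota a by rewrite NE subrK.
have piN : peval u pi = N by rewrite piE rmorphB /= horner_morphX horner_morphC NE.
rewrite piN in pik.
have cN y : GRing.comm y u -> GRing.comm y N.
  by move=> yu; rewrite NE; apply: commrB => //; apply: iotaC.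
have Nc y : GRing.comm y N -> GRing.comm y u.
  by move=> yu; rewrite uE; apply: commrD => //; apply: iotaC.
(* [D] is the eigenvalue of [d^2] on [e]. *)
pose D := a ^+ 2 - 4.
have wE : 'X ^+ 2 - 4%:P = D%:P + ('X - a%:P) * ('X + a%:P).
  by rewrite /D polyCB rmorphXn /=; ring.
have [D0|Dn0] := eqVneq D 0.
  have sgC (x : A) : GRing.comm (-1) x by apply/commr_sym/commrN1.
  have sg2 : -1 * -1 = 1 :> A by rewrite mulrNN mulr1.
  have dN : h * d = -1 * d * h by rewrite hd mulN1r mulNr.
  have an0 : a != 0.
    apply/eqP=> a0; move/eqP: D0.
    by rewrite /D a0 expr0n sub0r oppr_eq0 pnatr_eq0.
  have dd : d * d = (u + iota a) * N.
    rewrite -wu wE D0 add0r rmorphM rmorphB rmorphD /= horner_morphX horner_morphC.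
    by rewrite -NE (cN (u + iota a)) //; apply/commr_sym/commrD => //; apply: iotaC.
  have uN : GRing.comm u N by apply: cN.
  have uaN : GRing.comm (u + iota a) N.
    by apply/commr_sym/commrD; [apply: commr_sym|apply: iotaC].
  have [m [dm dm1]] : exists m, d ^+ m * e != 0 /\ d ^+ m.+1 * e = 0.
    apply: nilpotent_index; exists (2 * k)%N.
    by rewrite exprM expr2 dd exprMn_comm // -mulrA pik mulr0.
  (* [t = [y, u]] anticommutes with [u] because [y] commutes with
     [u^2 = d^2 + 4]; as the only eigenvalue of [u] is [a != 0], [t = 0]. *)
  have cmu y : e * y = y -> y * e = y -> GRing.comm y d -> GRing.comm y u.
    move=> ey ye yd.
    have [t tE] : exists t, t = y * u - u * y by eexists.
    have tu : t * u = - (u * t).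
      have uu : GRing.comm y (u * u).
        have -> : u * u = d * d + iota 4.
          rewrite -wu rmorphB rmorphXn /= horner_morphX horner_morphC expr2.
          by rewrite subrK.
        by apply: commrD; [apply: commrM|apply: iotaC].
      by rewrite tE mulrBl mulrBr opprB -!mulrA uu -mulrA.
    have tN : t * N = - ((u + iota a) * t).
      by rewrite NE mulrBr tu [(_ + iota a) * t]mulrDl opprD iotaC.
    have tNj j : t * N ^+ j = (-1) ^+ j * (u + iota a) ^+ j * t.
      elim: j => [|j IH]; first by rewrite !expr0 !mul1r mulr1.
      rewrite [N ^+ _]exprSr mulrA IH -[_ * t * N]mulrA tN mulrN.
      by rewrite ![_ ^+ j.+1]exprSr mulrN1 !mulNr !mulrA.
    have te : t * e = t by rewrite tE mulrBl -!mulrA ye -eu (mulrA y) ye.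
    have et : e * t = t by rewrite tE mulrBr !mulrA ey eu -[u * e * y]mulrA ey.
    have t0 : (u + iota a) ^+ k * t = 0.
      have : t * N ^+ k = 0.
        by rewrite -te -mulrA (commrX _ (cN _ eu)) pik mulr0.
      rewrite tNj => /(congr1 (fun x => (-1) ^+ k * x)).
      by rewrite -mulrA mulr0 signrMK.
    (* Both [(u - a)^k] and [(u + a)^k] kill [t]; they are coprime because [a] is nonzero. *)
    have cop : coprimep (('X - a%:P) ^+ k) (('X + a%:P) ^+ k).
      apply/coprimep_expl/coprimep_expr.
      by rewrite coprimep_sym coprimep_XsubC /root !hornerE -mulr2n mulrn_eq0.
    have /Bezout_eq1_coprimepP[[v1 v2] /= B] := cop.
    suff : t = 0 by rewrite tE => /eqP; rewrite subr_eq0 => /eqP.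
    have : peval u (v1 * ('X - a%:P) ^+ k + v2 * ('X + a%:P) ^+ k) * t = t.
      by rewrite B rmorph1 mul1r.
    rewrite rmorphD !rmorphM !rmorphXn rmorphB rmorphD /= !horner_morphX !horner_morphC.
    rewrite mulrDl -!mulrA t0 -NE -et (mulrA _ e) pik mul0r !mulr0 addr0.
    by rewrite et => <-.
  have [p [J [[pn0 pp ep pe] [JJ eJ Je [dp dJ] [hp hJ]]]]] :=
    odd_block sgC sg2 halfC half2 EE Ediv I0E I02 E0 ee hhe eh ed dN dm dm1.
  have gp : GRing.comm p g.
    by apply: commutes_with_g; [apply: cmu|]; last exact: commr_sym.
  (* By primitivity the block fills all of [e], so [J] squares to [- e]. *)
  have [p0|pE] := e_prim pp pe ep gp (commr_sym hp); first by rewrite p0 eqxx in pn0.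
  exists (h * J); apply: inverting_mul => //; first by rewrite JJ pE.
  by apply: commutes_with_g; [apply: cmu|]; last exact: commr_sym.
(* Now [d^2] is invertible on [e]; scaling [d] by a polynomial in [u] gives [I] with [I^2] equal to
   the sign of [D]. *)
have [r0 [t0 E0']] := sqrt_seed_linear Dn0 wE.
rewrite -piE in E0'; rewrite -piN in pik.
have [r] := peval_sqrt E0' pik; rewrite wu piN in pik *.
have [U UE] : exists U, U = peval u r by eexists.
rewrite -UE => UUdd.
have cU y : GRing.comm y u -> GRing.comm y U by rewrite UE; apply: peval_comm.
have dU : GRing.comm d U by apply: cU.
have [I IE] : exists I, I = d * U by eexists.
have hI : h * I = - (I * h).
  by rewrite IE mulrA hd mulNr -!mulrA (cU h) //; apply: commr_sym.
have Ih : I * h = - (h * I) by rewrite hI opprK.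
have II : I * I * e = (-1) ^+ (D < 0)%R * e.
  rewrite -UUdd IE; congr (_ * _).
  by rewrite -[RHS]mulrA (mulrA U d) -dU -!mulrA (mulrA U) -dU -!mulrA.
have Ic y : GRing.comm y u -> GRing.comm y d -> GRing.comm y I.
  by move=> yu yd; rewrite IE; apply: commrM => //; apply: cU.
have eI : GRing.comm e I by apply: Ic.
have Ig : GRing.comm I g.
  by apply/commr_sym/Ic; apply: commr_sym.
case: (D < 0)%R II UUdd => II UUdd; last first.
  (* As [h] and [I] anticommute, [(h I)^2 = - h^2 I^2], which is [- e] on [e]. *)
  exists (h * I * e); apply: inverting_corner => //.
  - exact: commrM.
  - rewrite -(mulrA h) (mulrA I) Ih mulNr mulrN mulNr; congr (- _).
    rewrite -!mulrA (mulrA I I) II mul1r mulrA; done.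
  - by rewrite -mulrA Ig !mulrA hg.
rewrite mulN1r in II.
have [m [Nm Nm1]] : exists m, N ^+ m * e != 0 /\ N ^+ m.+1 * e = 0.
  by apply: nilpotent_index; exists k.
have dcomm y : e * y = y -> y * e = y -> GRing.comm y N -> GRing.comm y I ->
    GRing.comm y d.
  move=> ey ye yN yI.
  have yu : GRing.comm y u by apply: Nc.
  (* This recovers [d] on [e] from [I] and [u], so commuting with [I] and [N] is enough to commute
     with [d]. *)
  have dE : d * e = - (I * (U * ((d * d) * e))).
    have -> : I * (U * (d * d * e)) = d * (U * U * (d * d) * e) by rewrite IE -!mulrA.
    by rewrite UUdd mulN1r mulrN opprK.
  have : GRing.comm y (d * e).
    rewrite dE -wu; apply/commrN/commrM => //; apply: commrM; first exact: cU.
    by apply: commrM; [apply: peval_comm|rewrite /GRing.comm ey].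
  by rewrite /GRing.comm -[d * e]ed mulrA ye ed -mulrA ey.
have IN : GRing.comm I N.
  by apply: cN; apply/commr_sym/Ic => //; apply: commr_sym.
have [p [J [[pn0 pp ep pe] [JJ eJ Je [Np hp Ip] [NJ hJ IJ]]]]] :=
  even_block halfC half2 EE E0 Ediv I0E I02 ee hhe eh (cN _ eu) (cN _ (commr_sym uh))
   Nm Nm1 II hI IN eI.
have cg y : e * y = y -> y * e = y -> GRing.comm N y -> GRing.comm I y ->
    GRing.comm y g.
  move=> ey ye /commr_sym yN /commr_sym yI; apply: commutes_with_g.
    exact: Nc.
  exact: dcomm.
have [p0|pE] := e_prim pp pe ep (cg _ ep pe Np Ip) (commr_sym hp).
  by rewrite p0 eqxx in pn0.
exists (h * J); apply: inverting_mul => //; first by rewrite JJ pE.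
exact: cg.
Qed.

End Reverser.

Theorem skew_reverser h h' : h * h' = 1 -> h' * h = 1 -> h * g = g' * h ->
  exists s, s * s = -1 /\ s * g = g' * s.
Proof.
move=> hh' h'h hg.
suff [s [_ _ ss sg]] : exists s, inverting 1 s by exists s.
apply: (@inverting_ind h 1); rewrite ?mulr1 //; try exact/commr_sym/commr1.
move=> e en0 ee eg eh _ e_prim.
have [c cE] : exists c, c = h * h by eexists.
have cg : GRing.comm c g.
  by rewrite /GRing.comm cE -mulrA hg mulrA reverser_sym // mulrA.
have ch : GRing.comm c h by rewrite /GRing.comm cE mulrA.
have ec : GRing.comm e c by rewrite cE; apply: commrM.
have [pi [k [rpi pik]]] := primary algebraic ee eg eh e_prim cg ch (commr_sym ec) en0.
have [b [r0 [t0 E0']]] : exists (b : bool) r0 t0,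
    r0 ^+ 2 * 'X = (-1) ^+ b + pi * t0.
  case: rpi pik => [[a ->] pik|[a [b [bn0 ->]]] _]; last first.
    by have [r0 [t0 H]] := sqrt_seed_quadratic a bn0; exists true, r0, t0.
  (* The eigenvalue 0 is excluded because [h] is invertible. *)
  have an0 : a != 0.
    apply/eqP => a0; case/eqP: en0.
    move: pik; rewrite a0 rmorphB /= horner_morphX horner_morphC rmorph0 subr0 cE.
    elim: k => [|k IH]; first by rewrite expr0 mul1r.
    rewrite exprS -!mulrA => /(congr1 (fun x => h' * (h' * x))).
    by rewrite !mulr0 !(mulrA h' h) h'h !mul1r !(mulrA h' h) h'h mul1r.
  have XE : 'X = a%:P + ('X - a%:P) * 1 by rewrite mulr1 addrC subrK.
  by have [r0 [t0 H]] := sqrt_seed_linear an0 XE; exists (a < 0)%R, r0, t0.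
have [r] := peval_sqrt E0' pik; rewrite horner_morphX => rrc.
have [U UE] : exists U, U = peval c r by eexists.
rewrite -UE in rrc.
have cU y : GRing.comm y c -> GRing.comm y U by rewrite UE; apply: peval_comm.
have eU := cU _ ec; have hU := cU _ (commr_sym ch); have gU := cU _ (commr_sym cg).
have sg : h * U * g = g' * (h * U) by rewrite -mulrA -gU !mulrA hg.
have ehU : GRing.comm e (h * U) by apply: commrM.
have ss : h * U * (h * U) * e = (-1) ^+ b * e.
  rewrite -rrc cE; congr (_ * _); rewrite {1}hU -!mulrA; congr (_ * _).
  by rewrite hU [LHS]mulrA hU mulrA.
case: b ss {E0' rrc} => ss.
  by exists (h * U * e); apply: inverting_corner => //; rewrite ss mulN1r.
rewrite mul1r in ss.
(* Here [h U] is an involution on [e]. Primitivity was relative to [h], so [e] is split again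
   relative to [h U], with [K] carrying the involution property to the pieces. *)
apply: (inverting_ind (h := h * U) (K := h * U * (h * U))) => //.
move=> f fn0 ff fg fh ffh f_prim.
exact: (involution_solution sg).
Qed.
End Solve.

(** * Quaternionic matrices *)

Section QuatMatrix.
Variable R : realType.
Local Notation quat := (quat R).

Definition qreal (a : R) : quat := Quat a 0 0 0.

Fact qreal_is_zmod_morphism : {morph qreal : a b / a - b}.
Proof. by move=> a b; congr Quat; rewrite ?subr0. Qed.
Fact qreal_is_monoid_morphism : monoid_morphism qreal.
Proof. by split=> // a b; congr Quat; ring. Qed.
HB.instance Definition _ :=
  GRing.isZmodMorphism.Build R quat qreal qreal_is_zmod_morphism.
HB.instance Definition _ :=
  GRing.isMonoidMorphism.Build R quat qreal qreal_is_monoid_morphism.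

Lemma qrealC a (q : quat) : q * qreal a = qreal a * q.
Proof. by case: q => x y z w; congr Quat => /=; ring. Qed.

Lemma quat_inverse (q : quat) : q != 0 -> exists p, p * q = 1.
Proof.
case: q => a b c d qn0; pose m := a ^+ 2 + b ^+ 2 + c ^+ 2 + d ^+ 2.
have mn0 : m != 0.
  apply: contraNneq qn0 => m0.
  have [a0 b0 c0 d0] : [/\ a ^+ 2 = 0, b ^+ 2 = 0, c ^+ 2 = 0 & d ^+ 2 = 0].
    have := (sqr_ge0 a, sqr_ge0 b, sqr_ge0 c, sqr_ge0 d); rewrite /m in m0.
    by move=> [[[? ?] ?] ?]; split; lra.
  move/eqP: a0; move/eqP: b0; move/eqP: c0; move/eqP: d0; rewrite !sqrf_eq0.
  by move=> /eqP-> /eqP-> /eqP-> /eqP->.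
exists (Quat (a / m) (- b / m) (- c / m) (- d / m)).
by congr Quat => /=; rewrite /m in mn0 *; field.
Qed.

(** * Quaternionic matrices as a finite-dimensional real algebra *)

Variable n : nat.
Local Notation A := 'M[quat]_n.+1.

Definition real_mx (a : R) : A := (qreal a)%:M.

Fact real_mx_is_zmod_morphism : {morph real_mx : a b / a - b}.
Proof. by move=> a b; rewrite /real_mx !rmorphB. Qed.
Fact real_mx_is_monoid_morphism : monoid_morphism real_mx.
Proof. by split=> [|a b]; rewrite /real_mx ?rmorph1 // !rmorphM. Qed.
HB.instance Definition _ :=
  GRing.isZmodMorphism.Build R A real_mx real_mx_is_zmod_morphism.
HB.instance Definition _ :=
  GRing.isMonoidMorphism.Build R A real_mx real_mx_is_monoid_morphism.

Lemma real_mxE a (c : A) i j : (real_mx a * c) i j = qreal a * c i j.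
Proof. by rewrite [real_mx a * c]mul_scalar_mx mxE. Qed.

Lemma real_mxC (c : A) : commr_rmorph real_mx c.
Proof.
move=> a; apply/matrixP=> i j; rewrite real_mxE mxE (bigD1 j) //= big1.
  by rewrite mxE eqxx mulr1n addr0 qrealC.
by move=> k kj; rewrite mxE (negbTE kj) mulr0n mulr0.
Qed.

Definition coordinate (l : 'I_4) (q : quat) : R :=
  tnth [tuple qre q; qi q; qj q; qk q] l.

Lemma coordinateM l a q : coordinate l (qreal a * q) = a * coordinate l q.
Proof.
case: q => x y z w; case: l => -[|[|[|[|//]]]] lt; rewrite /coordinate.
all: by rewrite (tnth_nth 0) [in RHS](tnth_nth 0) /=; ring.
Qed.

Lemma coordinateD l p q : coordinate l (p + q) = coordinate l p + coordinate l q.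
Proof.
by case: l => -[|[|[|[|//]]]] lt; rewrite /coordinate !(tnth_nth 0).
Qed.

Lemma coordinate0 l : coordinate l 0 = 0.
Proof. by apply: (addrI (coordinate l 0)); rewrite -coordinateD !addr0. Qed.

Lemma coordinate_eq0 q : (forall l, coordinate l q = 0) -> q = 0.
Proof.
case: q => x y z w q0.
have := (q0 (@Ordinal 4 0 isT), q0 (@Ordinal 4 1 isT),
  q0 (@Ordinal 4 2 isT), q0 (@Ordinal 4 3 isT)).
by rewrite /coordinate !(tnth_nth 0) /= => -[[[-> ->] ->] ->].
Qed.

Local Notation index := ('I_n.+1 * 'I_n.+1 * 'I_4)%type.

Definition real_row (c : A) : 'rV[R]_#|{: index}| :=
  \row_k coordinate (enum_val k).2 (c (enum_val k).1.1 (enum_val k).1.2).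

Lemma real_row_eq0 c : real_row c = 0 -> c = 0.
Proof.
move=> /rowP c0; apply/matrixP=> i j; rewrite mxE; apply: coordinate_eq0 => l.
by have := c0 (enum_rank (i, j, l)); rewrite !mxE enum_rankK.
Qed.

Lemma real_row_sum I (r : seq I) (a : I -> R) (c : I -> A) :
  real_row (\sum_(i <- r) real_mx (a i) * c i) = \sum_(i <- r) a i *: real_row (c i).
Proof.
elim: r => [|i r IH].
  by rewrite !big_nil; apply/rowP=> k; rewrite !mxE coordinate0.
rewrite !big_cons -IH; apply/rowP=> k; rewrite !mxE coordinateD.
by rewrite -coordinateM -real_mxE [(real_mx _ * _) _ _]mxE.
Qed.

(** More powers of [c] than the real dimension are linearly dependent; a kernel vector of the matrix
    of their coordinates lists the coefficients of [P]. *)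
Lemma quat_mx_algebraic (c : A) :
  exists2 P, P != 0 & horner_morph (real_mxC c) P = 0.
Proof.
set m := #|{: index}|.
pose K := \matrix_(i < m.+1) real_row (c ^+ i).
have : kermx K != 0.
  by rewrite kermx_eq0 /row_free neq_ltn ltnS rank_leq_col.
case/rowV0Pn=> v /sub_kermxP vK vn0; exists (rVpoly v).
  by apply: contra_neq vn0 => v0; rewrite -[v]rVpolyK v0 linear0.
apply: real_row_eq0; rewrite -vK mulmx_sum_row.
rewrite /horner_morph (@horner_coef_wide _ m.+1); last first.
  by apply: leq_trans (size_poly _ _) _; apply: size_poly.
under eq_bigr => i _ do rewrite coef_map /= coef_rVpoly_ord.
by rewrite real_row_sum; apply: eq_bigr => i _; rewrite rowK.
Qed.

(** Twice the quaternionic rank. *)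
Definition crank (c : A) := \rank (complex_mx c).

(** The row space of [f] lies in that of [e]; equality would give [e f = e], hence [f = e]. *)
Lemma crank_lt (e f : A) : e * e = e -> f * f = f -> e * f = f ->
  f * e = f -> f <> e -> (crank f < crank e)%N.
Proof.
move=> ee ff ef fe fne.
have sfe : (complex_mx f <= complex_mx e)%MS.
  by rewrite -fe [complex_mx (f * e)]complex_mxM submxMl.
have le := mxrank_leqif_sup sfe.
rewrite /crank ltn_neqAle le.1 andbT le.2; apply/negP => /submxP[X XE].
case: fne; apply: complex_mx_inj; rewrite -{1}ef [LHS]complex_mxM XE -mulmxA.
by rewrite -complex_mxM [f *m f]ff.
Qed.

Lemma mul_delta_delta (a b : quat) i j k l (x : A) :
  (a *: delta_mx i j) * x * (b *: delta_mx k l) = (a * x j k * b) *: delta_mx i l.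
Proof.
apply/matrixP=> p q; rewrite !mxE (bigD1 k) //= big1 => [|r rk]; last first.
  by rewrite !mxE (negbTE rk) !mulr0.
rewrite !mxE eqxx addr0 (bigD1 j) //= big1 => [|r rj]; last first.
  by rewrite !mxE (negbTE rj) andbF mulr0 mul0r.
rewrite !mxE eqxx addr0 andbT.
by case: (p == i); case: (q == l); rewrite ?(mulr0, mul0r, mulr1).
Qed.

Let E : A := delta_mx 0 0.
Let I0 : A := qunit_i R *: delta_mx 0 0.

Lemma quat_mx_skew_reverser (g g' h h' : A) :
    g * g' = 1 -> g' * g = 1 -> h * h' = 1 -> h' * h = 1 -> h * g = g' * h ->
  exists s : A, s * s = -1 /\ s * g = g' * s.
Proof.
have EE : E * E = E by rewrite [LHS]mul_delta_mx.
have E0 : E != 0.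
  by apply/eqP => /matrixP/(_ 0 0); rewrite !mxE !eqxx => /eqP; rewrite oner_eq0.
have Ediv x : x != 0 -> exists y z, E * y * x * z * E = E.
  move=> xn0; have [i [j xij]] : exists i j, x i j != 0.
    apply: contrapT => x0; case/eqP: xn0; apply/matrixP=> i j; rewrite mxE.
    by apply: contrapT => /eqP xij; apply: x0; exists i, j.
  have [q qx] := quat_inverse xij.
  (* These matrix units move the nonzero entry [x i j] to the corner, where [q] inverts it. *)
  exists (q *: delta_mx 0 i), (delta_mx j 0).
  have := mul_delta_delta q 1 0 i j 0 x; rewrite !scale1r qx mulr1 scale1r => H.
  have -> y z : E * y * x * z * E = E * (y * x * z) * E by rewrite !mulrA.
  by rewrite H -/E !EE.
have I0E : I0 * E = I0.
  have := mul_delta_delta (qunit_i R) 1 0 0 0 0 1.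
  by rewrite scale1r !mulr1 mxE mulr1.
have I02 : I0 * I0 = - E.
  have := mul_delta_delta (qunit_i R) (qunit_i R) 0 0 0 0 1.
  have [ii _ _ _] := hamilton_relations R.
  by rewrite !mulr1 mxE mulr1 ii scaleN1r.
move=> gg' g'g hh' h'h hg.
exact (skew_reverser quat_mx_algebraic crank_lt EE E0 Ediv I0E I02 gg' g'g hh' h'h hg).
Qed.

(** * Determinants of skew-involutions *)

Lemma det_sqr_neg1 (M : 'M[R[i]]_(n.+1 + n.+1)) : M *m M = - 1%:M -> \det M ^+ 2 = 1.
Proof.
move=> MM; rewrite expr2 -det_mulmx MM -scaleN1r detZ det1 mulr1.
by rewrite addnn -mul2n exprM sqrrN !expr1n.
Qed.

(** The symplectic matrix [J] conjugates the complex form of [x] to its complex conjugate. *)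
Lemma detq_real (x : A) : (detq x)^*%C = detq x.
Proof.
pose M := complex_mx x.
pose J : 'M[R[i]]_(n.+1 + n.+1) := block_mx 0 1%:M (- 1%:M) 0.
have JJ : J *m J = - 1%:M.
  rewrite mulmx_block !mul0mx !mulmx0 !addr0 !add0r mulmx1 mul1mx.
  by rewrite -[0 in LHS]oppr0 -opp_block_mx -scalar_mx_block.
have JM : J *m map_mx conjc M = M *m J.
  rewrite /M /J /complex_mx map_block_mx map_mxN /= !map_conjcK !mulmx_block.
  rewrite !mul0mx !mulmx0 !mul1mx !mulmx1 !mulNmx !mulmxN.
  by rewrite !mul1mx !mulmx1 !addr0 !add0r ?opprK.
have dJ : \det J != 0.
  by apply: contra_eq_neq (det_sqr_neg1 JJ) => ->; rewrite expr0n eq_sym oner_eq0.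
have := congr1 determinant JM; rewrite !det_mulmx det_map_mx mulrC => /(mulIf dJ).
by [].
Qed.

(* [s] is the square of [(1 + s) / sqrt 2], whose determinant is real. *)
Lemma detq_skew (s : A) : s * s = -1 -> detq s == 1.
Proof.
move=> ss; pose c := Num.sqrt 2^-1 : R.
have cc : c * c = 2^-1 by rewrite -expr2 sqr_sqrtr // invr_ge0 ler0n.
pose x := real_mx c * (1 + s).
have xx : x * x = s.
  have comm1 : (1 + s) * real_mx c = real_mx c * (1 + s) by apply: real_mxC.
  have s1 : (1 + s) * (1 + s) = s + s.
    by rewrite mulrDl mul1r mulrDr mulr1 ss addrCA [1 + s - 1]addrAC subrr add0r.
  rewrite /x mulrA -(mulrA (real_mx c)) comm1 mulrA -mulrA s1 -rmorphM cc.
  rewrite mulrDr -mulrDl -rmorphD; have -> : 2^-1 + 2^-1 = 1 :> R by field.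
  by rewrite rmorph1 mul1r.
have dx : detq s = detq x ^+ 2 by rewrite -xx [LHS]detqM expr2.
(* [detq s] is 1 or -1 and is the square of a real number, which leaves 1. *)
have := detq_real x; have : detq s ^+ 2 = 1.
  apply: det_sqr_neg1; rewrite -complex_mxM [s *m s]ss.
  have Z : complex_mx (-1 : A) + complex_mx (1 : A) = 0.
    apply/eqP; rewrite addr_eq0.
    rewrite /complex_mx !map_mxN opp_block_mx //.
  by apply/eqP; rewrite -addr_eq0 -[1%:M]complex_mx1 Z.
rewrite dx; case: (detq x) => a b /eqP d4 /eqP; rewrite eq_complex /= eqxx /=.
rewrite eq_sym -addr_eq0 -mulr2n mulrn_eq0 /= => /eqP b0.
move: d4; rewrite b0 complexr0 -!rmorphXn /= -(rmorph1 (real_complex R)).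
rewrite !(inj_eq (@complexI R)) sqrf_eq1 => /orP[] // /eqP a2.
by have := sqr_ge0 a; rewrite a2 oppr_ge0 ler10.
Qed.

End QuatMatrix.

(** * Passage between matrices and the group *)

Theorem theorem1p4 (R : realType) (n : nat) (hn : (1 <= n)%N) (g : slH R n) :
  reversible g <->
  exists s t : slH R n,
    [/\ skew_involution s, skew_involution t & g = (s * t)%g].
Proof.
case: n hn g => // n _ g; split=> [[h hgh]|[s [t [ss tt ->]]]].
  have hg : (h * g = g^-1 * h)%g by rewrite -hgh mulgVK.
  have valM (x y z : slH R n.+1) : (x * y = z)%g ->
      slH_val x * slH_val y = slH_val z :> 'M[quat R]_n.+1.
    by move=> <-.
  have gg' := valM _ _ _ (mulgV g); have g'g := valM _ _ _ (mulVg g).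
  have hh' := valM _ _ _ (mulgV h); have h'h := valM _ _ _ (mulVg h).
  have [s [ss sg]] := quat_mx_skew_reverser gg' g'g hh' h'h (congr1 val hg).
  pose S := SLH (detq_skew ss).
  have S'E : slH_val (S^-1)%g = - s.
    have /(congr1 (fun x => - s * x)) := valM _ _ _ (mulgV S).
    by rewrite mulrA mulNr ss opprK mul1r mulr1.
  (* Since [S^-1 = - s], the second factor squares to [s g s g = g^-1 s^2 g = -1]. *)
  exists S, (S^-1 * g)%g; split=> //; last by rewrite mulVKg.
  rewrite /skew_involution -[LHS]/(slH_val (S^-1 * g)%g * slH_val (S^-1 * g)%g).
  have -> : slH_val (S^-1 * g)%g = - s * slH_val g by rewrite -S'E.
  rewrite mulrA !(mulNr, mulrN) opprK.
  by rewrite sg -!mulrA (mulrA s) ss mulN1r mulrN g'g.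
exists s.
(* Conversely [s] reverses [s t]: [s s t = t^3 = t^-1], hence [s (s t) s^-1 = t^-1 s^-1]. *)
have st : (s * s = t * t)%g by apply: val_inj; rewrite /= ss tt.
have t4 : (t * t * (t * t) = 1)%g.
  by apply: val_inj; rewrite /= tt mulNmx mul1mx opprK.
have t3 : (t * t * t = t^-1)%g by apply/eqP; rewrite -mulg_eq1 -mulgA t4.
by rewrite mulgA st t3 invgM.
Qed.
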